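(* Let $A$ be a ring with Jacobson radical $J=J(A)$ such that $A/J$ is semisimple and $J^3=0$. The following assertions are equivalent: (1) The global dimension of $A$ is finite. (2) $\mathrm{Ext}_A^n(S,S)=0$ for all simple $A$-modules $S$ and all $n\gg 0$ (i.e. there is an $m>0$ such that $\mathrm{Ext}_A^n(S,S)=0$ for all simple $A$-modules $S$ and all $n\ge m$). (3) Every simple $A$-module has either finite projective dimension or finite injective dimension.
   Context: All rings are associative with unit and ''module'' means left module. A ring $A$ as in the claim is semiprimary (its Jacobson radical is nilpotent and $A/J$ is semisimple), so its left, right and weak global dimensions coincide and one speaks of the global dimension. *)

(* Defs.v *)
From HB Require Import structures.
From mathcomp Require Import all_boot all_order all_algebra.
From mathcomp Require Import boolp classical_sets functions cardinality fsbigop.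

Set Implicit Arguments.
Unset Strict Implicit.
Unset Printing Implicit Defensive.

Import GRing.Theory.

Local Open Scope ring_scope.

(* All modules are left modules: [lmodType A] for [A : pzRingType].  The ring *)
(* may be noncommutative, and the zero ring is allowed.                       *)

Section Modules.
Variable A : pzRingType.
Implicit Types M N : lmodType A.

Definition zero_module M : Prop := forall x : M, x = 0.

Definition simple_module M : Prop :=
  ~ zero_module M /\
  forall S : {pred M}, GRing.submod_closed S ->
    (forall x, x \in S -> x = 0) \/ (forall x, x \in S).

Definition semisimple_module M : Prop :=
  forall S : {pred M}, GRing.submod_closed S ->
  exists T : {pred M},
    [/\ GRing.submod_closed T,
        forall x, x \in S -> x \in T -> x = 0 &
        forall x, exists s t, [/\ s \in S, t \in T & x = s + t]].

Definition projective_module (P : lmodType A) : Prop :=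
  forall (M N : lmodType A) (g : {linear M -> N}) (f : {linear P -> N}),
    (forall y, exists x, g x = y) ->
    exists h : {linear P -> M}, forall x, g (h x) = f x.

Definition injective_module (I : lmodType A) : Prop :=
  forall (M N : lmodType A) (g : {linear M -> N}) (f : {linear M -> I}),
    injective g ->
    exists h : {linear N -> I}, forall x, h (g x) = f x.

(* ... -> P_2 -> P_1 -> P_0 -> M -> 0 exact, with every P_n projective.       *)
Record proj_resolution M := ProjResolution {
  pres_mod :> nat -> lmodType A;
  pres_aug : {linear pres_mod 0 -> M};
  pres_diff : forall n, {linear pres_mod n.+1 -> pres_mod n};
  pres_proj : forall n, projective_module (pres_mod n);
  pres_aug_surj : forall y, exists x, pres_aug x = y;
  pres_exact0 : forall x, pres_aug x = 0 <-> exists y, pres_diff 0 y = x;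
  pres_exactS : forall n x,
    pres_diff n x = 0 <-> exists y, pres_diff n.+1 y = x
}.

(* 0 -> M -> I^0 -> I^1 -> I^2 -> ... exact, with every I^n injective.        *)
Record inj_resolution M := InjResolution {
  ires_mod :> nat -> lmodType A;
  ires_aug : {linear M -> ires_mod 0};
  ires_diff : forall n, {linear ires_mod n -> ires_mod n.+1};
  ires_inj : forall n, injective_module (ires_mod n);
  ires_aug_inj : injective ires_aug;
  ires_exact0 : forall x, ires_diff 0 x = 0 <-> exists y, ires_aug y = x;
  ires_exactS : forall n x,
    ires_diff n.+1 x = 0 <-> exists y, ires_diff n y = x
}.

Definition projdim_le M (d : nat) : Prop :=
  exists P : proj_resolution M, forall n, (d < n)%N -> zero_module (P n).

Definition injdim_le M (d : nat) : Prop :=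
  exists I : inj_resolution M, forall n, (d < n)%N -> zero_module (I n).

Definition finite_projdim M : Prop := exists d, projdim_le M d.
Definition finite_injdim M : Prop := exists d, injdim_le M d.

End Modules.

(* The left global dimension, i.e. the supremum of the projective dimensions  *)
(* of all left modules, is finite.                                            *)
Definition finite_gldim (A : pzRingType) : Prop :=
  exists d, forall M : lmodType A, projdim_le M d.

Section LinearOf.
Variables (A : pzRingType) (U V : lmodType A) (f : U -> V) (lf : linear f).

Definition linear_of := f.
HB.instance Definition _ := GRing.isLinear.Build A U V *:%R linear_of lf.
Definition linear_of_linear : {linear U -> V} := linear_of.

End LinearOf.

Section Kernel.
Variables (A : pzRingType) (U V : lmodType A) (f : {linear U -> V}).

Definition kernel : {pred U} := [pred x | f x == 0].

Lemma kernel_submod : GRing.submod_closed kernel.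
Proof.
split=> [|a x y]; rewrite !inE ?linear0 // => /eqP fx /eqP fy.
by rewrite linearP fx fy scaler0 addr0.
Qed.

HB.instance Definition _ := GRing.isSubmodClosed.Build A U kernel kernel_submod.

Definition kernel_module := {x : U | x \in kernel}.
HB.instance Definition _ := SubChoice.on kernel_module.
HB.instance Definition _ := [SubChoice_isSubLmodule of kernel_module by <:].

Definition kernel_incl : {linear kernel_module -> U} :=
  (\val : kernel_module -> U).

End Kernel.

(* The free module on a set X: finitely supported functions X -> A.           *)
Section FreeModule.
Variables (A : pzRingType) (X : choiceType).

Definition finsupp : {pred X -> A^o} :=
  [pred f | `[< exists s : seq X, forall x, x \notin s -> f x = 0 >]].

Lemma finsuppP (f : X -> A^o) :
  reflect (exists s : seq X, forall x, x \notin s -> f x = 0) (f \in finsupp).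
Proof. exact: asboolP. Qed.

Lemma finsupp_submod : GRing.submod_closed finsupp.
Proof.
split=> [|a f g /finsuppP[s fs] /finsuppP[t gt]]; apply/finsuppP.
  by exists [::].
exists (s ++ t) => x; rewrite mem_cat negb_or => /andP[/fs fx /gt gx].
by rewrite [LHS]/= /GRing.add /= /GRing.scale /= fx gx scaler0 addr0.
Qed.

HB.instance Definition _ :=
  GRing.isSubmodClosed.Build A (X -> A^o) finsupp finsupp_submod.

Definition free_module := {f : X -> A^o | f \in finsupp}.
HB.instance Definition _ := SubChoice.on free_module.
HB.instance Definition _ := [SubChoice_isSubLmodule of free_module by <:].

End FreeModule.

Section FreeModuleTheory.
Variables (A : pzRingType) (X : choiceType).
Local Notation F := (free_module A X).

Definition fcoef (f : F) (x : X) : A := val f x.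

Definition free_ext_fun (M : lmodType A) (c : X -> M) (f : F) : M :=
  \sum_(x \in [set: X]) fcoef f x *: c x.

Lemma free_extE (M : lmodType A) (c : X -> M) (f : F) (s : seq X) :
  (forall x, x \notin s -> fcoef f x = 0) ->
  free_ext_fun c f = \sum_(x <- undup s) fcoef f x *: c x.
Proof.
move=> fs; rewrite [RHS]fsbig_seq ?undup_uniq //.
symmetry; apply: fsbig_widen => // x [_ /= /negP].
by rewrite mem_undup => /fs fx; rewrite fx scale0r.
Qed.

Lemma free_ext_linear (M : lmodType A) (c : X -> M) : linear (free_ext_fun c).
Proof.
move=> a f g.
have /finsuppP[s fs] := valP f; have /finsuppP[t gt] := valP g.
have fst x : x \notin s ++ t -> fcoef f x = 0.
  by rewrite mem_cat negb_or => /andP[/fs].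
have gst x : x \notin s ++ t -> fcoef g x = 0.
  by rewrite mem_cat negb_or => /andP[_ /gt].
have fgst x : x \notin s ++ t -> fcoef (a *: f + g) x = 0.
  move=> xst; rewrite -[LHS]/(a * fcoef f x + fcoef g x).
  by rewrite fst // gst // mulr0 addr0.
rewrite (free_extE _ fst) (free_extE _ gst) (free_extE _ fgst).
rewrite scaler_sumr -big_split; apply: eq_bigr => x _ /=.
by rewrite -[LHS]/((a * fcoef f x + fcoef g x) *: c x) scalerDl scalerA.
Qed.

Definition free_ext (M : lmodType A) (c : X -> M) : {linear F -> M} :=
  linear_of_linear (free_ext_linear c).

Lemma free_delta_subproof (x : X) :
  (fun y : X => (y == x)%:R : A^o) \in @finsupp A X.
Proof.
by apply/finsuppP; exists [:: x] => y; rewrite inE => /negPf ->.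
Qed.

Definition free_delta (x : X) : F :=
  exist (fun f => f \in @finsupp A X) _ (free_delta_subproof x).

Lemma fcoef_delta (x y : X) : fcoef (free_delta x) y = (y == x)%:R.
Proof. by []. Qed.

Lemma fcoef_is_linear (x : X) : linear (fcoef^~ x : F -> A^o).
Proof. by []. Qed.

Lemma free_ext_delta (M : lmodType A) (c : X -> M) (x : X) :
  free_ext c (free_delta x) = c x.
Proof.
rewrite [LHS](@free_extE _ _ _ [:: x]) => [|y]; last first.
  by rewrite inE fcoef_delta => /negPf ->.
by rewrite /= big_seq1 fcoef_delta eqxx scale1r.
Qed.

Lemma free_decomp (f : F) : free_ext free_delta f = f.
Proof.
have /finsuppP[s fs] := valP f.
rewrite [LHS](free_extE _ fs); apply/val_inj/funext => y.
rewrite -[RHS]/(fcoef f y).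
pose cy : {linear F -> A^o} := linear_of_linear (fcoef_is_linear y).
rewrite -[LHS]/(cy _) raddf_sum.
transitivity (\sum_(x <- undup s) fcoef f x * (y == x)%:R).
  by apply: eq_bigr => x _.
have [ys|ys] := boolP (y \in undup s).
  rewrite (bigD1_seq y) ?undup_uniq //= eqxx mulr1 big1 ?addr0 // => x.
  by rewrite eq_sym => /negPf ->; rewrite mulr0.
have -> : fcoef f y = 0 by apply: fs; rewrite -mem_undup.
rewrite big_seq big1 // => x xs.
by case: eqP xs ys => [->->//|_ _ _]; rewrite mulr0.
Qed.

Lemma free_ext_comp (M N : lmodType A) (c : X -> M) (g : {linear M -> N})
    (f : F) : g (free_ext c f) = free_ext (g \o c) f.
Proof.
have /finsuppP[s fs] := valP f.
rewrite /= /linear_of !(free_extE _ fs) linear_sum.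
by apply: eq_bigr => x _; rewrite linearZ.
Qed.

Lemma free_module_projective : projective_module F.
Proof.
move=> M N g f gsurj.
pose c x := sval (cid (gsurj (f (free_delta x)))).
have gc x : g (c x) = f (free_delta x) by rewrite /c; case: cid.
exists (free_ext c) => x; rewrite free_ext_comp -[in RHS](free_decomp x).
rewrite free_ext_comp; congr (free_ext_fun _ x); exact/funext.
Qed.

End FreeModuleTheory.

(* The canonical free resolution of M: the n-th syzygy [syzygy M n.+1] is the *)
(* kernel of the counit of the free module on the underlying set of           *)
(* [syzygy M n].                                                              *)
Section FreeResolution.
Variables (A : pzRingType) (M : lmodType A).

Definition free_counit (N : lmodType A) : {linear free_module A N -> N} :=
  free_ext (id : N -> N).

Lemma free_counit_surj (N : lmodType A) y : exists x, free_counit N x = y.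
Proof. by exists (free_delta A y); rewrite free_ext_delta. Qed.

Fixpoint syzygy (n : nat) : lmodType A :=
  if n is m.+1 then kernel_module (free_counit (syzygy m)) else M.

Definition free_res_mod (n : nat) : lmodType A := free_module A (syzygy n).

Definition free_res_diff (n : nat) :
    {linear free_res_mod n.+1 -> free_res_mod n} :=
  kernel_incl (free_counit (syzygy n)) \o free_counit (syzygy n.+1).

Lemma free_res_diff_image n x :
  free_counit (syzygy n) x = 0 <-> exists y, free_res_diff n y = x.
Proof.
split=> [x0|[y <-]]; last exact/eqP/(valP (free_counit (syzygy n.+1) y)).
have kx : x \in kernel (free_counit (syzygy n)) by exact/eqP.
have [y yx] := @free_counit_surj (syzygy n.+1)
  (exist (fun u => u \in kernel _) x kx).
by exists y; rewrite /= yx.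
Qed.

Lemma free_res_exactS n x :
  free_res_diff n x = 0 <-> exists y, free_res_diff n.+1 y = x.
Proof.
rewrite -free_res_diff_image; split=> [x0|xk]; last by rewrite /= xk.
exact/val_inj.
Qed.

Definition free_resolution : proj_resolution M :=
  @ProjResolution A M free_res_mod (free_counit M) free_res_diff
    (fun n => @free_module_projective A (syzygy n))
    (@free_counit_surj M) (@free_res_diff_image 0) free_res_exactS.

End FreeResolution.

(* The n-th cohomology group of the complex Hom_A(P_0, N) -> Hom_A(P_1, N) -> *)
(* ... of a projective resolution P of M, as n-cocycles modulo n-coboundaries *)
(* (Hom_A(P_n, N) is the group of the linear functions among P_n -> N).       *)
Section Cohomology.
Variables (A : pzRingType) (M N : lmodType A) (P : proj_resolution M).

Definition cocycle (n : nat) (f : P n -> N) : Prop :=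
  linear f /\ forall x, f (pres_diff P n x) = 0.

Definition coboundary (n : nat) : (P n -> N) -> Prop :=
  match n return (P n -> N) -> Prop with
  | 0 => fun f => forall x, f x = 0
  | m.+1 => fun f =>
      exists g : {linear P m -> N}, forall x, f x = g (pres_diff P m x)
  end.

Definition cocycles (n : nat) : {pred P n -> N} := [pred f | `[< cocycle f >]].
Arguments cocycles : clear implicits.

Lemma cocycles_zmod n : zmod_closed (cocycles n).
Proof.
split=> [|f g /asboolP[lf fd] /asboolP[lg gd]]; apply/asboolP; split.
- by move=> a x y /=; rewrite -[RHS]/(a *: (0 : N) + 0) scaler0 addr0.
- by [].
- move=> a x y; rewrite -[LHS]/(f (a *: x + y) - g (a *: x + y)).
  by rewrite lf lg -[RHS]/(a *: (f x - g x) + (f y - g y)) scalerBr addrACA opprD.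
- by move=> x; rewrite -[LHS]/(f _ - g _) fd gd subr0.
Qed.

HB.instance Definition _ n :=
  GRing.isZmodClosed.Build (P n -> N) (cocycles n) (cocycles_zmod n).

Definition cocycle_group (n : nat) := {f : P n -> N | f \in cocycles n}.
HB.instance Definition _ n := SubChoice.on (cocycle_group n).
HB.instance Definition _ n := [SubChoice_isSubZmodule of cocycle_group n by <:].

Definition coboundaries (n : nat) : {pred cocycle_group n} :=
  [pred f | `[< coboundary (val f) >]].
Arguments coboundaries : clear implicits.

Lemma coboundaries_zmod n : zmod_closed (coboundaries n).
Proof.
split=> [|f g /asboolP Bf /asboolP Bg]; apply/asboolP.
  by case: n => [//|n]; exists \0 => x.
case: n f g Bf Bg => [|n] f g /=.
  by move=> f0 g0 x; rewrite -[LHS]/(sval f x - sval g x) f0 g0 subr0.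
move=> [u fu] [v gv]; exists (u \- v) => x.
by rewrite -[LHS]/(sval f x - sval g x) fu gv.
Qed.

HB.instance Definition _ n :=
  GRing.isZmodClosed.Build (cocycle_group n) (coboundaries n)
    (coboundaries_zmod n).

Definition cohomology (n : nat) : zmodType := Quotient.quot (coboundaries n).

Lemma cohomology0P n :
  (forall c : cohomology n, c = 0) <->
  (forall f : P n -> N, cocycle f -> coboundary f).
Proof.
have piE0 (g : cocycle_group n) :
    (\pi g == 0 :> Quotient.quot (coboundaries n))%qT = (g \in coboundaries n).
  by rewrite -[g in RHS]subr0 Quotient.idealrBE raddf0.
split=> [H0 f cf|H c].
  have fk : f \in cocycles n by exact/asboolP.
  pose g : cocycle_group n := exist (fun g => g \in cocycles n) f fk.
  have /eqP := H0 (\pi_(Quotient.quot (coboundaries n)) g)%qT.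
  by rewrite piE0 => /asboolP.
rewrite -[c]reprK; apply/eqP; rewrite piE0; apply/asboolP/H.
exact/asboolP/(valP (repr c)).
Qed.

End Cohomology.

Definition Ext (A : pzRingType) (n : nat) (M N : lmodType A) : zmodType :=
  cohomology N (free_resolution M) n.

Section JacobsonRadical.
Variable A : pzRingType.

(* A^o is A as a left module over itself; its submodules are the left ideals. *)
Definition left_ideal (I : {pred A}) : Prop :=
  GRing.submod_closed (I : {pred A^o}).

Definition maximal_left_ideal (I : {pred A}) : Prop :=
  [/\ left_ideal I, 1 \notin I &
      forall L : {pred A}, left_ideal L -> {subset I <= L} ->
        {subset L <= I} \/ (forall x, x \in L)].

Definition jacobson : {pred A} :=
  [pred x | `[< forall I, maximal_left_ideal I -> x \in I >]].

Lemma left_idealMl (I : {pred A}) a x : left_ideal I -> x \in I -> a * x \in I.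
Proof. by case=> I0 II xI; have := II a _ _ xI I0; rewrite addr0. Qed.

Lemma left_idealD (I : {pred A}) x y :
  left_ideal I -> x \in I -> y \in I -> x + y \in I.
Proof. by case=> I0 II xI; have := II 1 _ y xI; rewrite scale1r. Qed.

Lemma jacobsonP x :
  reflect (forall I, maximal_left_ideal I -> x \in I) (x \in jacobson).
Proof. exact: asboolP. Qed.

Lemma jacobson_left_ideal : left_ideal jacobson.
Proof.
split=> [|a x y /jacobsonP xJ /jacobsonP yJ]; apply/jacobsonP => I mI.
  by have [[]] := mI.
by have [[_ II] _ _] := mI; apply: II; [exact: xJ|exact: yJ].
Qed.

Lemma jacobson_zmod : zmod_closed jacobson.
Proof. exact: GRing.submod_closedB jacobson_left_ideal. Qed.

HB.instance Definition _ := GRing.isZmodClosed.Build A jacobson jacobson_zmod.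

Lemma jacobsonMl a x : x \in jacobson -> a * x \in jacobson.
Proof. exact: left_idealMl jacobson_left_ideal. Qed.

(* For a maximal left ideal I and a in A, {y | y a \in I} is either A or a    *)
(* maximal left ideal.                                                        *)
Lemma jacobsonMr a x : x \in jacobson -> x * a \in jacobson.
Proof.
move=> /jacobsonP xJ; apply/jacobsonP => I [lI I1 maxI].
pose L : {pred A} := [pred y | y * a \in I].
have lL : left_ideal L.
  split=> [|b y z yL zL]; first by rewrite inE mul0r; case: lI.
  rewrite inE; have [_ /(_ b _ _ yL zL)] := lI.
  by rewrite -[_ *: _]/(b * (y * a)) mulrDl mulrA.
have [L1|L1] := boolP (1 \in L).
  by have := left_idealMl x lL L1; rewrite mulr1.
apply: (xJ L); split=> // L' lL' LL'.
have [L'L|/existsNP[b /not_implyP[bL' /negP bL]]] := pselect {subset L' <= L}.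
  by left.
right=> y; rewrite -[y]mulr1; apply: left_idealMl => //.
pose K : {pred A} :=
  [pred z | `[< exists i r, i \in I /\ z = i + r * (b * a) >]].
have lK : left_ideal K.
  split=> [|c z w /asboolP[i [r [iI ->]]] /asboolP[j [s [jI ->]]]].
    apply/asboolP; exists 0, 0; rewrite mul0r addr0; split=> //.
    by case: lI.
  apply/asboolP; exists (c * i + j), (c * r + s); split.
    by apply: left_idealD => //; exact: left_idealMl.
  by rewrite -[_ *: _]/(c * _) mulrDr mulrDl addrACA mulrA.
have IK : {subset I <= K}.
  by move=> i iI; apply/asboolP; exists i, 0; rewrite mul0r addr0.
have [KI|KT] := maxI K lK IK.
  case/negP: bL; apply: KI; apply/asboolP; exists 0, 1.
  by rewrite mul1r add0r; split=> //; case: lI.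
have /asboolP[i [r [iI ai]]] := KT a.
have rL : 1 - r * b \in L.
  by rewrite inE mulrBl mul1r {1}ai -mulrA addrK.
rewrite -[1](subrK (r * b)); apply: left_idealD => //; first exact: LL'.
exact: left_idealMl.
Qed.

(* The library only makes quotients of commutative rings into rings, so the    *)
(* multiplication of A/J is put here on the library's quotient group.          *)
Definition jacobson_quotient := Quotient.quot jacobson.
HB.instance Definition _ := GRing.Zmodule.on jacobson_quotient.
Local Notation Q := jacobson_quotient.
Local Notation pi := (\pi_(Quotient.quot jacobson))%qT.

Lemma jacobson_piE x y : pi x = pi y <-> x - y \in jacobson.
Proof. by rewrite Quotient.idealrBE; split=> /eqP. Qed.

Lemma jacobson_piD x y : pi (x + y) = pi x + pi y.
Proof. exact: raddfD. Qed.

Definition jacobson_quotient_one : Q := pi 1.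
Definition jacobson_quotient_mul (x y : Q) : Q :=
  pi (repr (x : Quotient.quot jacobson) * repr (y : Quotient.quot jacobson))%qT.

Lemma jacobson_piM x y : pi (x * y) = jacobson_quotient_mul (pi x) (pi y).
Proof.
rewrite /jacobson_quotient_mul.
set x' := repr (pi x); set y' := repr (pi y); apply/jacobson_piE.
have xx' : x - x' \in jacobson by apply/jacobson_piE; rewrite reprK.
have yy' : y - y' \in jacobson by apply/jacobson_piE; rewrite reprK.
have -> : x * y - x' * y' = (x - x') * y + x' * (y - y').
  by rewrite mulrBl mulrBr addrA subrK.
by apply: rpredD; [exact: jacobsonMr | exact: jacobsonMl].
Qed.

Local Notation mulQ := jacobson_quotient_mul.

Lemma jacobson_pi_surj (q : Q) : exists x, q = pi x.
Proof. by exists (repr (q : Quotient.quot jacobson)); rewrite reprK. Qed.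

Lemma jacobson_quotient_mulA : associative mulQ.
Proof.
move=> q r s; have [x ->] := jacobson_pi_surj q.
have [y ->] := jacobson_pi_surj r; have [z ->] := jacobson_pi_surj s.
rewrite -(jacobson_piM y z) -(jacobson_piM x y) -(jacobson_piM x (y * z)).
by rewrite -(jacobson_piM (x * y) z) mulrA.
Qed.

Lemma jacobson_quotient_mul1 : left_id jacobson_quotient_one mulQ.
Proof.
by move=> q; have [x ->] := jacobson_pi_surj q; rewrite -(jacobson_piM 1 x) mul1r.
Qed.

Lemma jacobson_quotient_mulr1 : right_id jacobson_quotient_one mulQ.
Proof.
by move=> q; have [x ->] := jacobson_pi_surj q; rewrite -(jacobson_piM x 1) mulr1.
Qed.

Lemma jacobson_quotient_mulDl : left_distributive mulQ +%R.
Proof.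
move=> q r s; have [x ->] := jacobson_pi_surj q.
have [y ->] := jacobson_pi_surj r; have [z ->] := jacobson_pi_surj s.
rewrite -(jacobson_piD x y) -(jacobson_piM x z) -(jacobson_piM y z).
by rewrite -(jacobson_piM (x + y) z) -(jacobson_piD (x * z)) mulrDl.
Qed.

Lemma jacobson_quotient_mulDr : right_distributive mulQ +%R.
Proof.
move=> q r s; have [x ->] := jacobson_pi_surj q.
have [y ->] := jacobson_pi_surj r; have [z ->] := jacobson_pi_surj s.
rewrite -(jacobson_piD y z) -(jacobson_piM x y) -(jacobson_piM x z).
by rewrite -(jacobson_piM x (y + z)) -(jacobson_piD (x * y)) mulrDr.
Qed.

HB.instance Definition _ := GRing.Zmodule_isPzRing.Build Q
  jacobson_quotient_mulA jacobson_quotient_mul1 jacobson_quotient_mulr1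
  jacobson_quotient_mulDl jacobson_quotient_mulDr.

End JacobsonRadical.

Arguments jacobson A _ : clear implicits.

Definition semisimple_ring (R : pzRingType) : Prop := semisimple_module R^o.

(* Main.v *)
(* Only (2) => (1) is hard. Let X be semisimple, with minimal projective       *)
(* resolution P and syzygies Om n X. As J^3 = 0, the part of the first syzygy  *)
(* of any module lying in J^2 P_0 is semisimple and, up to its intersection    *)
(* with the radical of the syzygy, splits off as a direct summand. Iterating,  *)
(* Om n X is the direct sum of syzygies Om (n - k) N_k of semisimple modules    *)
(* N_k and of a "linear" part, whose top embeds into the n-th syzygy of X over *)
(* A/J^2. Accordingly a nonzero class in Tor_n(A/J, X) can be followed through *)
(* a chain of simple modules S_0, S_1, ... : when it is nonzero in the linear  *)
(* part, in steps of degree one; in general, once the linear parts of large    *)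
(* degree g are known to vanish, in steps of degree at most g. For a < b some  *)
(* map Om d S_a -> S_b is nonzero, that is Ext^d(S_a, S_b) <> 0, where d is    *)
(* the degree between the two terms. As there are finitely many simple         *)
(* modules, a long chain contains two isomorphic terms far apart,              *)
(* contradicting (2). The first kind of chain bounds the linear parts, the     *)
(* second kind then bounds the projective dimensions.                          *)

From HB Require Import structures.
Require Import Defs.
From mathcomp Require Import all_boot all_order all_algebra.
From mathcomp Require Import boolp classical_sets.

Set Implicit Arguments.
Unset Strict Implicit.
Unset Printing Implicit Defensive.

Import GRing.Theory.
Local Open Scope ring_scope.

(** * Submodules, graphs of linear maps and quotients *)

Section Submodules.
Variable A : pzRingType.
Implicit Types M N Y V : lmodType A.

(** Implications towards (2): a projective resolution of finite length kills high Ext in the first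
    argument ([projdim_Ext0]), an injective one in the second ([injdim_Ext0]). Up to isomorphism
    there are finitely many simple modules ([finitely_many_simples]), so the bounds coming from (3)
    can be made uniform.

    For (2) => (1), minimal syzygies [Om n M] lie in the radical of a projective module, so Ext^n(M,
    T) = 0 with n > 0 and T semisimple forces every map [Om n M] -> T to be zero ([Ext_Om_map0]).
    Hence (2) forbids nonzero maps from a late syzygy of a simple module to that module. An element
    that survives in a very high syzygy is traced through a long chain of simple modules; some
    isomorphism class recurs at least m degrees later, a contradiction ([chain_bound]). This is
    applied first to linear parts ([linear_zero_bound]), then to whole syzygies ([Om_eventually0]),
    where J^3 = 0 supplies steps of bounded degree ([omega_split], [top_injective_cov],
    [split_step]). All minimal resolutions then stop at a common degree ([finite_gldim_of_Om]).

    Modules are arbitrary, so finiteness enters elementwise: an element of a syzygy depends on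
    finitely many elements of the module ([Om_support]), and on these the identity of a semisimple
    module agrees with a finite sum of maps through simple modules ([finite_rank_fix]). Together
    they give [select_simple]. *)

Definition submod M (U : M -> Prop) : Prop :=
  U 0 /\ forall a x y, U x -> U y -> U (a *: x + y).

Section SubmodTheory.
Variables (M : lmodType A) (U : M -> Prop) (sU : submod U).

Lemma submodD x y : U x -> U y -> U (x + y).
Proof. by move=> Ux Uy; rewrite -[x]scale1r; apply: sU.2. Qed.

Lemma submodZ a x : U x -> U (a *: x).
Proof. by move=> Ux; rewrite -[_ *: _]addr0; apply: sU.2 => //; case: sU. Qed.

Lemma submodN x : U x -> U (- x).
Proof. by rewrite -scaleN1r; exact: submodZ. Qed.

Lemma submodB x y : U x -> U y -> U (x - y).
Proof. by move=> Ux /submodN; exact: submodD. Qed.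

Lemma submod_pred : GRing.submod_closed ([pred x | `[< U x >]] : {pred M}).
Proof.
split=> [|a x y /asboolP Ux /asboolP Uy]; apply/asboolP; first by case: sU.
exact: sU.2.
Qed.

End SubmodTheory.

Lemma linear_of_graph Y V (R : Y -> V -> Prop) :
    (forall y, exists v, R y v) ->
    (forall y v v', R y v -> R y v' -> v = v') ->
    (forall a y v y' v', R y v -> R y' v' -> R (a *: y + y') (a *: v + v')) ->
  exists f : {linear Y -> V}, forall y, R y (f y).
Proof.
move=> Rex Rfun Rlin; pose f y := sval (cid (Rex y)).
have fP y : R y (f y) by rewrite /f; case: cid.
have lf : linear f by move=> a x y; apply: (Rfun _ _ _ (fP _)); apply: Rlin.
by exists (linear_of_linear lf).
Qed.

Lemma submod_preim M N (f : {linear M -> N}) (U : N -> Prop) :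
  submod U -> submod (fun x => U (f x)).
Proof.
move=> sU; split=> [|a x y Ux Uy]; first by rewrite linear0; case: sU.
by rewrite linearP; apply: sU.2.
Qed.

Lemma submod_im M N (f : {linear M -> N}) (U : M -> Prop) :
  submod U -> submod (fun y => exists2 x, U x & f x = y).
Proof.
move=> sU; split=> [|a y y' [x Ux <-] [x' Ux' <-]].
  by exists 0; [case: sU|exact: linear0].
by exists (a *: x + x'); [exact: sU.2|exact: linearP].
Qed.

Lemma submod_eq0 M : submod (fun x : M => x = 0).
Proof. by split=> // a x y -> ->; rewrite scaler0 addr0. Qed.

Lemma submod_True M : submod (fun x : M => True).
Proof. by []. Qed.

Section Span.
Variables (M : lmodType A) (G : M -> Prop).

Definition submod_span (x : M) : Prop :=
  forall U, submod U -> (forall y, G y -> U y) -> U x.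

Lemma submod_span_closed : submod submod_span.
Proof.
split=> [|a x y sx sy] U sU GU; first by case: sU.
by apply: sU.2; [exact: sx|exact: sy].
Qed.

Lemma submod_span_gen x : G x -> submod_span x.
Proof. by move=> Gx U _; apply. Qed.

Lemma submod_span_ind (U : M -> Prop) :
  submod U -> (forall y, G y -> U y) -> forall x, submod_span x -> U x.
Proof. by move=> sU GU x; apply. Qed.

End Span.

Lemma kernel_mem M N (f : {linear M -> N}) (w : kernel_module f) : f (val w) = 0.
Proof. exact/eqP/(valP w). Qed.

Lemma kernel_elt M N (f : {linear M -> N}) x :
  f x = 0 -> exists w : kernel_module f, val w = x.
Proof.
by move=> fx; exists (exist (fun u => u \in kernel f) x (introT eqP fx)).
Qed.

Lemma kernel_lift M N Y (f : {linear M -> N}) (g : {linear Y -> M}) :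
  (forall y, f (g y) = 0) ->
  exists h : {linear Y -> kernel_module f}, forall y, val (h y) = g y.
Proof.
move=> fg; apply: (@linear_of_graph _ _ (fun y w => val w = g y)).
- by move=> y; exact: kernel_elt.
- by move=> y v v' <- ?; exact/val_inj.
- by move=> a y v y' v' vy vy'; rewrite linearP /= vy vy' -linearP.
Qed.

(* The library's quotients only give the underlying group.                    *)
Section Quotient.
Variables (M : lmodType A) (U : M -> Prop) (sU : submod U).

Definition quotient_pred : {pred M} := [pred x | `[< U x >]].
Lemma quotient_pred_zmod : zmod_closed quotient_pred.
Proof. exact: GRing.submod_closedB (submod_pred sU). Qed.
HB.instance Definition _ :=
  GRing.isZmodClosed.Build M quotient_pred quotient_pred_zmod.

Definition quotient_module := Quotient.quot quotient_pred.
HB.instance Definition _ := GRing.Zmodule.on quotient_module.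
Local Notation Q := quotient_module.
Local Notation pi := (\pi_(Quotient.quot quotient_pred))%qT.

Lemma quotient_piE x y : pi x = pi y <-> U (x - y).
Proof.
have piE := Quotient.idealrBE quotient_pred x y.
split=> [e|Uxy].
  by apply/asboolP; rewrite -[`[< _ >]]/(_ \in quotient_pred) piE e eqxx.
by apply/eqP; rewrite -piE; apply/asboolP.
Qed.

Lemma quotient_surj (q : Q) : exists x, q = pi x.
Proof. by exists (repr (q : Quotient.quot quotient_pred)); rewrite reprK. Qed.

Definition quotient_scale (a : A) (q : Q) : Q :=
  pi (a *: repr (q : Quotient.quot quotient_pred))%qT.

Lemma quotient_scaleE a x : quotient_scale a (pi x) = pi (a *: x).
Proof.
apply/quotient_piE; rewrite -scalerBr; apply: submodZ => //.
by apply/quotient_piE; rewrite reprK.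
Qed.

Lemma quotient_piD x y : (pi (x + y) : Q) = pi x + pi y.
Proof. exact: raddfD. Qed.

Lemma quotient_scaleA a b q :
  quotient_scale a (quotient_scale b q) = quotient_scale (a * b) q.
Proof. by have [x ->] := quotient_surj q; rewrite !quotient_scaleE scalerA. Qed.

Lemma quotient_scale1 : left_id 1 quotient_scale.
Proof.
by move=> q; have [x ->] := quotient_surj q; rewrite quotient_scaleE scale1r.
Qed.

Lemma quotient_scaleDr : right_distributive quotient_scale +%R.
Proof.
move=> a q r; have [x ->] := quotient_surj q; have [y ->] := quotient_surj r.
by rewrite -quotient_piD !quotient_scaleE scalerDr quotient_piD.
Qed.

Lemma quotient_scaleDl q : {morph quotient_scale^~ q : a b / a + b}.
Proof.
move=> a b; have [x ->] := quotient_surj q.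
by rewrite !quotient_scaleE scalerDl quotient_piD.
Qed.

HB.instance Definition _ := GRing.Zmodule_isLmodule.Build A Q
  quotient_scaleA quotient_scale1 quotient_scaleDr quotient_scaleDl.

Lemma quotient_pi_linear : linear (pi : M -> Q).
Proof. by move=> a x y; rewrite quotient_piD -quotient_scaleE. Qed.

Lemma quotientP : exists (Q : lmodType A) (q : {linear M -> Q}),
  (forall y, exists x, q x = y) /\ (forall x, q x = 0 <-> U x).
Proof.
exists Q, (linear_of_linear quotient_pi_linear); split=> [y|x].
  by have [x ->] := quotient_surj y; exists x.
have -> : (0 : Q) = linear_of_linear quotient_pi_linear 0 by rewrite linear0.
by rewrite -[x in U x]subr0; exact: quotient_piE.
Qed.

End Quotient.

Lemma factor_surj M N V (q : {linear M -> N}) (f : {linear M -> V}) :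
    (forall y, exists x, q x = y) -> (forall x, q x = 0 -> f x = 0) ->
  exists g : {linear N -> V}, forall x, g (q x) = f x.
Proof.
move=> qs qf; have [|||g gP] :=
  @linear_of_graph N V (fun y v => exists2 x, q x = y & f x = v).
- by move=> y; have [x <-] := qs y; exists (f x), x.
- move=> y v v' [x <- <-] [x' qx <-]; apply/eqP; rewrite -subr_eq0 -linearB.
  by rewrite qf // linearB qx subrr.
- move=> a y v y' v' [x <- <-] [x' <- <-].
  by exists (a *: x + x'); rewrite linearP.
exists g => x; have [x' qx <-] := gP (q x); apply/eqP.
by rewrite -subr_eq0 -linearB qf // linearB qx subrr.
Qed.

Lemma factor_inj M N V (i : {linear M -> N}) (f : {linear V -> N}) :
    injective i -> (forall v, exists x, i x = f v) ->
  exists g : {linear V -> M}, forall v, i (g v) = f v.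
Proof.
move=> ii fi; apply: (@linear_of_graph V M (fun v x => i x = f v)) => //.
  by move=> y v v' <- /ii.
by move=> a y v y' v' e e'; rewrite !linearP e e'.
Qed.

Lemma linear_inj0 M N (f : {linear M -> N}) :
  (forall x, f x = 0 -> x = 0) -> injective f.
Proof.
move=> f0 x y fxy; apply/eqP; rewrite -subr_eq0; apply/eqP/f0.
by rewrite linearB fxy subrr.
Qed.

End Submodules.

(** * The radical and semisimple modules *)

Section Radical.
Variable A : pzRingType.
Implicit Types M N L X Y : lmodType A.
Local Notation J := (jacobson A).

Definition rad M : M -> Prop :=
  submod_span (fun x => exists j y, j \in J /\ x = j *: y).
Definition rad2 M : M -> Prop :=
  submod_span (fun x => exists j y, [/\ j \in J, rad y & x = j *: y]).

Lemma rad_submod M : submod (@rad M). Proof. exact: submod_span_closed. Qed.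
Lemma rad2_submod M : submod (@rad2 M). Proof. exact: submod_span_closed. Qed.

Lemma rad_ind M (U : M -> Prop) : submod U ->
  (forall j y, j \in J -> U (j *: y)) -> forall x, rad x -> U x.
Proof.
by move=> sU UJ; apply: submod_span_ind => // _ [j [y [jJ ->]]]; exact: UJ.
Qed.

Lemma rad2_ind M (U : M -> Prop) : submod U ->
  (forall j y, j \in J -> rad y -> U (j *: y)) -> forall x, rad2 x -> U x.
Proof.
by move=> sU UJ; apply: submod_span_ind => // _ [j [y [jJ ry ->]]]; exact: UJ.
Qed.

Lemma rad_scale M j (x : M) : j \in J -> rad (j *: x).
Proof. by move=> jJ; apply: submod_span_gen; exists j, x. Qed.

Lemma rad2_scale M j (x : M) : j \in J -> rad x -> rad2 (j *: x).
Proof. by move=> jJ rx; apply: submod_span_gen; exists j, x. Qed.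

Lemma rad_map M N (f : {linear M -> N}) x : rad x -> rad (f x).
Proof.
move: x; apply: rad_ind => [|j y jJ]; first exact/submod_preim/rad_submod.
by rewrite linearZ; exact: rad_scale.
Qed.

Lemma rad2_map M N (f : {linear M -> N}) x : rad2 x -> rad2 (f x).
Proof.
move: x; apply: rad2_ind => [|j y jJ ry]; first exact/submod_preim/rad2_submod.
by rewrite linearZ; apply: rad2_scale => //; exact: rad_map.
Qed.

Lemma rad_to_rad2 M N (f : {linear M -> N}) x :
  (forall y, rad (f y)) -> rad x -> rad2 (f x).
Proof.
move=> fr; move: x; apply: rad_ind => [|j y jJ].
  exact/submod_preim/rad2_submod.
by rewrite linearZ; exact: rad2_scale.
Qed.

Lemma rad_lift M N (f : {linear M -> N}) y :
  (forall y, exists x, f x = y) -> rad y -> exists2 x, rad x & f x = y.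
Proof.
move=> fs; move: y; apply: rad_ind => [|j z jJ].
  exact/submod_im/rad_submod.
by have [x <-] := fs z; exists (j *: x); [exact: rad_scale|rewrite linearZ].
Qed.

(* As A/J is semisimple, these are the semisimple modules.                    *)
Definition killed X : Prop := forall j (x : X), j \in J -> j *: x = 0.

Lemma killed_rad X (x : X) : killed X -> rad x -> x = 0.
Proof.
move=> kX; move: x; apply: rad_ind => [|j y jJ]; first exact: submod_eq0.
exact: kX.
Qed.

Lemma killed_kernel X Y (f : {linear X -> Y}) : killed X -> killed (kernel_module f).
Proof. by move=> kX j x jJ; apply/val_inj; rewrite -[LHS]/(j *: val x) kX. Qed.

Lemma killed_quotient M N (q : {linear M -> N}) :
  (forall y, exists x, q x = y) -> (forall x, q x = 0 <-> rad x) -> killed N.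
Proof.
move=> qs q0 j y jJ; have [x <-] := qs y.
by rewrite -linearZ; apply/q0; exact: rad_scale.
Qed.

Section Semiprimary.
Hypothesis ssA : semisimple_ring (jacobson_quotient A).
Hypothesis J3 : forall x y z : A, x \in J -> y \in J -> z \in J -> x * y * z = 0.

Lemma scale_rad2 M i (x : M) : i \in J -> rad2 x -> i *: x = 0.
Proof.
have r1 : forall x : M, rad x -> forall i j, i \in J -> j \in J -> i *: (j *: x) = 0.
  apply: rad_ind => [|k y kJ i' j iJ jJ]; last by rewrite !scalerA J3 // scale0r.
  split=> [|a y z hy hz] i' j iJ jJ; first by rewrite !scaler0.
  by rewrite !scalerDr hz // addr0 (scalerA j) hy //; exact: jacobsonMr.
move=> iJ rx; move: x rx i iJ; apply: rad2_ind => [|j y jJ ry i iJ]; last exact: r1.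
split=> [|a x y hx hy] i iJ; first by rewrite scaler0.
by rewrite scalerDr hy // addr0 (scalerA i) hx //; exact: jacobsonMr.
Qed.

(** If JM = M then M = J^2 M, which J kills because J^3 = 0; so M = JM = 0. Nilpotency makes this
    valid for every module. *)
Lemma nakayama M : (forall x : M, rad x) -> forall x : M, x = 0.
Proof.
move=> rM.
have r2 (x : M) : rad2 x.
  apply: (rad_ind (rad2_submod M)) (rM x) => j y jJ; exact: rad2_scale.
move=> x; apply: killed_rad (rM x) => j y jJ; exact: scale_rad2.
Qed.

Lemma left_ideal_complement (I : A -> Prop) :
    @submod A A^o I -> (forall j, j \in J -> I j) ->
  exists C : A -> Prop, [/\ @submod A A^o C, forall a, I a -> C a -> a \in J &
    forall a, exists i c, [/\ I i, C c & a = i + c]].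
Proof.
move=> sI JI; pose Q := jacobson_quotient A.
pose pi (x : A) : Q := (\pi_(Quotient.quot J) x)%qT.
pose S : {pred Q^o} := [pred q | `[< exists2 x, I x & pi x = q >]].
have piZ (a x : A) : pi (a * x) = pi a *: (pi x : Q^o) by exact: jacobson_piM.
have sS : GRing.submod_closed S.
  split=> [|a _ _ /asboolP[x Ix <-] /asboolP[y Iy <-]]; apply/asboolP.
    by exists 0; [case: sI|exact: raddf0].
  have [b ->] := jacobson_pi_surj a; exists (b *: (x : A^o) + y); first exact: sI.2.
  by rewrite /pi (jacobson_piD (b * x) y) -/(pi _) piZ.
have [T [sT ST TT]] := ssA sS.
exists (fun a => pi a \in T); split.
- split=> [|a x y Tx Ty]; first by rewrite /pi raddf0; case: sT.
  by rewrite -[_ *: _]/(a * x) /pi (jacobson_piD (a * x) y) -/(pi _) piZ; exact: sT.2.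
- move=> a Ia Ta; have pa0 : pi a = 0.
    by apply: ST => //; apply/asboolP; exists a.
  have /jacobson_piE : pi a = pi 0 by rewrite pa0 /pi raddf0.
  by rewrite subr0.
- move=> a; have [s [t [/asboolP[i Ii <-] Tt e]]] := TT (pi a).
  exists i, (a - i); split=> //; last by rewrite addrC subrK.
  suff -> : pi (a - i) = t by [].
  by rewrite /pi raddfB /= -/(pi a) e addrAC subrr add0r.
Qed.

Lemma zorn_submod M (D : M -> Prop) (Q : (M -> Prop) -> Prop) :
    submod D -> Q D ->
    (forall (I : Type) (U : I -> M -> Prop), (forall i, Q (U i)) -> I ->
      (forall i j, (forall x, U i x -> U j x) \/ (forall x, U j x -> U i x)) ->
      Q (fun x => exists i, U i x)) ->
  exists U : M -> Prop, [/\ submod U, forall x, D x -> U x, Q U &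
    forall V, submod V -> (forall x, U x -> V x) -> Q V -> forall x, V x -> U x].
Proof.
move=> sD QD Qchain.
pose P (U : set M) := U = set0 \/ [/\ submod U, forall x, D x -> U x & Q U].
have [F FP Ftot|U [PU Umax]] := @Zorn_bigcup M P.
  have [[Z0 [FZ0 Z00]]|F0] := pselect (exists B, F B /\ B <> set0); last first.
    left; apply/seteqP; split=> // x [B FB Bx].
    by case: F0; exists B; split=> // B0; rewrite B0 in Bx.
  right; pose I := {B : set M | F B /\ B <> set0}.
  have PI (i : I) : [/\ submod (sval i), forall x, D x -> sval i x & Q (sval i)].
    by case: i => B [FB B0] /=; case: (FP _ FB).
  have Itot (i j : I) : (forall x, sval i x -> sval j x) \/
      (forall x, sval j x -> sval i x).
    by case: i j => B [FB B0] [C [FC C0]] /=; have [] := Ftot _ _ FB FC; [left|right].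
  pose i0 : I := exist _ Z0 (conj FZ0 Z00).
  have UE : (\bigcup_(B in F) B)%classic = fun x => exists i : I, sval i x.
    apply/funext => x; apply/propext; split=> [[B FB Bx]|[[B [FB B0'] Bx]]].
      have B0' : B <> set0 by move=> e; rewrite e in Bx.
      by exists (exist _ B (conj FB B0')).
    by exists B.
  rewrite UE; split.
  - split=> [|a x y [i Ux] [j Uy]]; first by exists i0; case: (PI i0) => -[].
    have [ij|ji] := Itot i j.
      by exists j; case: (PI j) => -[_ h] _ _; apply: h => //; exact: ij.
    by exists i; case: (PI i) => -[_ h] _ _; apply: h => //; exact: ji.
  - by move=> x Dx; exists i0; case: (PI i0) => _ h _; exact: h.
  - by apply: (Qchain I (fun i => sval i)) => // i; case: (PI i).
have U0 : U <> set0.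
  move=> U0; apply: (Umax D); last by right.
  split=> [x|]; first by rewrite U0.
  by move=> /(_ 0) DU; have := DU sD.1; rewrite U0.
case: PU => [//|[sU DU QU]]; exists U; split=> // V sV UV QV x Vx.
apply: contrapT => nUx; apply: (Umax V); last first.
  by right; split=> // y /DU /UV.
by split=> // VU; apply/nUx/VU.
Qed.

Section Killed.
Variables (X : lmodType A) (kX : killed X).

(** Take C maximal among submodules meeting S in 0. The scalars sending x into S + C form a left
    ideal I containing J. If L complements I modulo J, then C + Lx still meets S in 0, since L and I
    meet inside J and J kills x. So Lx lies in C, and splitting 1 along I and L puts x in S + C. *)
Lemma killed_complement (S : X -> Prop) : submod S ->
  exists C : X -> Prop, [/\ submod C, forall x, S x -> C x -> x = 0 &
    forall x, exists s c, [/\ S s, C c & x = s + c]].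
Proof.
move=> sS.
have [|x _ -> //|I U UP _ _ x Sx [i Uix]|C [sC _ CP Cmax]] :=
  @zorn_submod X (fun x => x = 0) (fun U => forall x, S x -> U x -> x = 0).
- exact: submod_eq0.
- exact: UP Uix.
exists C; split=> // x; apply: contrapT => nx.
pose I (a : A) := exists s c, [/\ S s, C c & a *: x = s + c].
have sI : @submod A A^o I.
  split=> [|a b b' [s [c [Ss Cc e]]] [s' [c' [Ss' Cc' e']]]].
    by exists 0, 0; rewrite scale0r addr0; split=> //; [case: sS|case: sC].
  exists (a *: s + s'), (a *: c + c'); split; [exact: sS.2|exact: sC.2|].
  by rewrite -[_ *: _ + b']/(a * b + b') scalerDl -scalerA e e' scalerDr addrACA.
have JI j : j \in J -> I j.
  by move=> jJ; exists 0, 0; rewrite kX // addr0; split=> //; [case: sS|case: sC].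
have [L [sL IL LT]] := left_ideal_complement sI JI.
have [i [l [Ii Ll e1]]] := LT 1.
pose V y := exists c b, [/\ C c, L b & y = c + b *: x].
have sV : submod V.
  split=> [|a y z [c [b [Cc Lb ->]]] [c' [b' [Cc' Lb' ->]]]].
    by exists 0, 0; rewrite scale0r addr0; split=> //; [case: sC|case: sL].
  exists (a *: c + c'), (a * b + b'); split; [exact: sC.2|exact: sL.2|].
  by rewrite scalerDl -scalerA scalerDr addrACA.
have CV y : C y -> V y.
  by move=> Cy; exists y, 0; rewrite scale0r addr0; split=> //; case: sL.
have QV y : S y -> V y -> y = 0.
  move=> Sy [c [b [Cc Lb e]]].
  have bx : b *: x = y - c by rewrite e addrC addKr.
  have Ib : I b by exists y, (- c); split=> //; exact: submodN.
  have b0 : b *: x = 0 by apply/kX/IL.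
  by apply: CP Sy _; rewrite e b0 addr0.
have Cl : C (l *: x).
  apply: (Cmax V sV CV QV); exists 0, l; rewrite add0r; split=> //; by case: sC.
apply: nx; have [s [c [Ss Cc e]]] := Ii.
exists s, (c + l *: x); split=> //; first exact: submodD.
by rewrite addrA -e -scalerDl -e1 scale1r.
Qed.

Lemma killed_projection (S : X -> Prop) : submod S ->
  exists p : {linear X -> X}, (forall x, S (p x)) /\ (forall x, S x -> p x = x).
Proof.
move=> sS; have [C [sC SC CT]] := killed_complement sS.
have [|||p pP] := @linear_of_graph _ X X (fun x s => S s /\ C (x - s)).
- by move=> x; have [s [c [Ss Cc ->]]] := CT x; exists s; rewrite addrC addKr.
- move=> x s s' [Ss Cs] [Ss' Cs']; apply/eqP; rewrite -subr_eq0; apply/eqP/SC.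
    exact: submodB.
  by have := submodB sC Cs' Cs; rewrite opprB addrC subrKA.
- move=> a x s x' s' [Ss Cs] [Ss' Cs']; split; first exact: sS.2.
  by rewrite opprD addrACA -scalerBr; exact: sC.2.
exists p; split=> x; first by case: (pP x).
move=> Sx; have [Sp Cp] := pP x; apply/eqP; rewrite eq_sym -subr_eq0.
by apply/eqP/SC => //; exact: submodB.
Qed.

End Killed.

(** Von Neumann regularity: r kills a complement of the image of c and inverts c from the image onto
    a complement of the kernel. *)
Lemma killed_regular X Y (c : {linear X -> Y}) : killed X -> killed Y ->
  exists r : {linear Y -> X},
    (forall x, c (r (c x)) = c x) /\ (forall y, r (c (r y)) = r y).
Proof.
move=> kX kY.
have [t [tker t1]] := killed_projection kX (submod_preim c (submod_eq0 Y)).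
have [p [pim p1]] := killed_projection kY (submod_im c (submod_True X)).
have wd x x' : c x = c x' -> x - t x = x' - t x'.
  move=> e; have xx' : t (x - x') = x - x'.
    by apply: t1; rewrite linearB e subrr.
  apply/eqP; rewrite -subr_eq0.
  have -> : x - t x - (x' - t x') = x - x' - (t x - t x') by rewrite !opprD addrACA.
  by rewrite -xx' linearB subrr.
have [|||r rP] :=
  @linear_of_graph _ Y X (fun y z => exists2 x, c x = p y & z = x - t x).
- by move=> y; have [x _ cx] := pim y; exists (x - t x), x.
- by move=> y v v' [x cx ->] [x' cx' ->]; apply: wd; rewrite cx cx'.
- move=> a y v y' v' [x cx ->] [x' cx' ->]; exists (a *: x + x').
    by rewrite !linearP cx cx'.
  by rewrite linearP opprD addrACA -scalerBr.
have crE y : c (r y) = p y.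
  by have [x cx ->] := rP y; rewrite linearB tker subr0.
have pc x : p (c x) = c x by apply: p1; exists x.
exists r; split=> [x|y]; first by rewrite crE pc.
have [x cx ->] := rP (c (r y)); have [x' cx' ->] := rP y.
by apply: wd; rewrite cx crE p1 // ; exists x'.
Qed.

Lemma killed_retraction X Y (i : {linear Y -> X}) : killed X -> injective i ->
  exists r : {linear X -> Y}, forall y, r (i y) = y.
Proof.
move=> kX ii; have kY : killed Y.
  by move=> j y jJ; apply: ii; rewrite linearZ /= kX // linear0.
by have [r [ir _]] := killed_regular i kY kX; exists r => y; exact/ii/ir.
Qed.

End Semiprimary.
End Radical.

(** * Simple modules *)

Section Simple.
Variable A : pzRingType.
Implicit Types M N L X Y S T : lmodType A.
Local Notation J := (jacobson A).

Lemma simpleP S : simple_module S <->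
  (exists x : S, x <> 0) /\
  forall U : S -> Prop, submod U -> (forall x, U x -> x = 0) \/ (forall x, U x).
Proof.
split=> [[/existsNP nz sS]|[[x nz] sS]]; split=> //.
- move=> U sU; have [h|h] := sS _ (submod_pred sU); [left|right] => x.
    by move=> Ux; apply/h/asboolP.
  exact/asboolP/h.
- by move=> U [U0 sU]; apply: (sS (fun x => x \in U)).
Qed.

Definition isomorphic S T : Prop :=
  exists (f : {linear S -> T}) (g : {linear T -> S}),
    (forall x, g (f x) = x) /\ (forall y, f (g y) = y).

Lemma isomorphic_sym S T : isomorphic S T -> isomorphic T S.
Proof. by move=> [f [g [gf fg]]]; exists g, f. Qed.

Lemma isomorphic_trans S T X : isomorphic S T -> isomorphic T X -> isomorphic S X.
Proof.
move=> [f [g [gf fg]]] [f' [g' [gf' fg']]].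
by exists (f' \o f), (g \o g'); split=> x /=; rewrite ?gf' ?gf ?fg ?fg'.
Qed.

Lemma simple_inj S X (h : {linear S -> X}) x :
  simple_module S -> h x <> 0 -> injective h.
Proof.
move=> /simpleP[_ sS] hx; apply: linear_inj0.
by have [//|h0] := sS _ (submod_preim h (submod_eq0 X)).
Qed.

Lemma simple_isomorphic S T (h : {linear S -> T}) x :
  simple_module S -> simple_module T -> h x <> 0 -> isomorphic S T.
Proof.
move=> sS sT hx; have hi := simple_inj sS hx.
have /simpleP[_ sT'] := sT.
have [h0|hs] := sT' _ (submod_im h (submod_True S)).
  by case: hx; apply: h0; exists x.
have [|||g gP] := @linear_of_graph _ T S (fun y z => h z = y).
- by move=> y; have [z _ hz] := hs y; exists z.
- by move=> y v v' <- /hi.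
- by move=> a y v y' v' <- <-; exact: linearP.
by exists h, g; split=> // z; apply: hi; rewrite gP.
Qed.

Section Semiprimary.
Hypothesis ssA : semisimple_ring (jacobson_quotient A).
Hypothesis J3 : forall x y z : A, x \in J -> y \in J -> z \in J -> x * y * z = 0.

Lemma simple_killed S : simple_module S -> killed S.
Proof.
move=> /simpleP[[x nz] sS]; have [r0|rT] := sS _ (@rad_submod A S).
  by move=> j y jJ; apply: r0; exact: rad_scale.
by case: nz; exact: (nakayama J3).
Qed.

(** For x outside D take U containing D and maximal without x. By maximality every nonzero submodule
    of a complement of U contains the component s of x there, so two of them cannot meet in 0; the
    complement is simple, hence inside D, which is absurd. *)
Lemma killed_socle X (D : X -> Prop) : killed X -> submod D ->
    (forall S (i : {linear S -> X}), simple_module S -> forall y, D (i y)) ->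
  forall x, D x.
Proof.
move=> kX sD Dsimple x; apply: contrapT => Dx.
have [I U UP _ _ [i Ux]|U [sU DU Ux Umax]] :=
  zorn_submod (Q := fun U => ~ U x) sD Dx; first exact: UP Ux.
have [p [pU p1]] := killed_projection ssA kX sU.
have p0 y : p (y - p y) = 0 by rewrite linearB (p1 (p y)) ?subrr.
have [s sE] := kernel_elt (p0 x).
have sn0 : s <> 0.
  move=> s0; apply: Ux; move/eqP: sE; rewrite s0 /= eq_sym subr_eq0 => /eqP->.
  exact: pU.
have kS := killed_kernel (f := p) kX.
have sS : simple_module (kernel_module p).
  apply/simpleP; split; first by exists s.
  move=> T sT; have [[t [Tt nt]]|nT] := pselect (exists t, T t /\ t <> 0); last first.
    by left=> t Tt; apply: contrapT => nt; apply: nT; exists t.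
  right; have [C [sC TC TCT]] := killed_complement ssA kS sT.
  have key (W : kernel_module p -> Prop) w : submod W -> W w -> w <> 0 -> W s.
    move=> sW Ww nw; pose V y := exists u w, [/\ U u, W w & y = u + val w].
    have sV : submod V.
      split=> [|a y z [u [b [Uu Wb ->]]] [u' [b' [Uu' Wb' ->]]]].
        by exists 0, 0; rewrite add0r; split=> //; [case: sU|case: sW].
      exists (a *: u + u'), (a *: b + b'); split; [exact: sU.2|exact: sW.2|].
      by rewrite -[val (a *: b + b')]/(a *: val b + val b') scalerDr addrACA.
    have UV y : U y -> V y.
      by move=> Uy; exists y, 0; rewrite /= addr0; split=> //; case: sW.
    have [] := pselect (V x); last first.
      move=> nVx; have Uw := Umax V sV UV nVx (val w).
      case: nw; apply/val_inj; rewrite -[LHS]p1 ?kernel_mem //.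
      by apply: Uw; exists 0, w; rewrite add0r; split=> //; case: sU.
    move=> [u [b [Uu Wb e]]]; suff <- : b = s by [].
    apply/val_inj; rewrite sE e linearD kernel_mem addr0 p1 //.
    by rewrite addrC addKr.
  move=> y; have [t' [c [Tt' Cc ->]]] := TCT y.
  have [->|/eqP c0] := eqVneq c 0; first by rewrite addr0.
  by case: sn0; apply: TC; [exact: (key T t)|exact: (key C c)].
apply: sn0; apply/val_inj; rewrite -[LHS]p1 ?kernel_mem //.
exact/DU/(Dsimple _ (kernel_incl p)).
Qed.

(** Every simple module receives a map from A/J that is nonzero at 1. The elements of A/J on which
    maps to only finitely many classes of simple modules can be nonzero form a submodule containing
    the image of every simple module, so 1 is among them by [killed_socle]. *)
Lemma finitely_many_simples :
  exists v (L : nat -> lmodType A),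
    forall S, simple_module S -> exists2 i, (i < v)%N & isomorphic S (L i).
Proof.
have sJ : @submod A A^o (fun a => a \in J).
  by have [? ?] := jacobson_left_ideal A.
have [Q [q [qs q0]]] := quotientP sJ.
have kQ : killed Q.
  move=> j y jJ; have [a <-] := qs y; rewrite -linearZ; apply/q0.
  by rewrite -[_ *: _]/(j * a); exact: jacobsonMr.
pose D (x : Q) := exists v (L : nat -> lmodType A),
  forall S (f : {linear Q -> S}), simple_module S -> f x <> 0 ->
    exists2 i, (i < v)%N & isomorphic S (L i).
have sD : submod D.
  split=> [|a x y [v [L LP]] [v' [L' LP']]].
    by exists 0%N, (fun=> Q) => S f _; rewrite linear0.
  exists (v + v')%N, (fun i => if (i < v)%N then L i else L' (i - v)%N).
  move=> S f sS; rewrite linearP => nz.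
  have [fx|/eqP fx] := eqVneq (f x) 0.
    have [|i iv SL] := LP' S f sS.
      by move=> fy; apply: nz; rewrite fx fy scaler0 addr0.
    by exists (v + i)%N; rewrite ?ltn_add2l // ltnNge leq_addr /= addKn.
  have [i iv SL] := LP S f sS fx; exists i; last by rewrite iv.
  by rewrite (leq_trans iv) // leq_addr.
have [|v [L LP]] := killed_socle kQ sD _ (q 1).
  move=> S i sS y; exists 1%N, (fun=> S) => T f sT fiy; exists 0%N => //.
  exact/isomorphic_sym/(simple_isomorphic (h := f \o i) sS sT fiy).
exists v, L => S sS; have kS := simple_killed sS.
have /simpleP[[x nx] _] := sS.
have lx : linear (fun a : A^o => (a : A) *: x).
  by move=> a b c; rewrite -[X in X *: x]/(a * (b : A) + c) scalerDl scalerA.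
have [|f fq] := factor_surj (f := linear_of_linear lx) qs.
  by move=> a /q0 aJ; exact: kS.
by apply: (LP S f sS); rewrite fq /= /linear_of scale1r.
Qed.

Inductive finite_rank X (e : {linear X -> X}) : Prop :=
| Finite_rank0 of (forall x, e x = 0)
| Finite_rankS (e' : {linear X -> X}) S (h : {linear X -> S}) (i : {linear S -> X})
    of simple_module S & finite_rank e' & (forall x, e x = e' x + i (h x)).

Lemma finite_rank_comp X (e f g : {linear X -> X}) :
  finite_rank e -> (forall x, g x = e (f x)) -> finite_rank g.
Proof.
move=> fe; elim: fe g => [{}e e0|{}e e' S h i sS _ IH eE] g gE.
  by apply: Finite_rank0 => x; rewrite gE.
apply: (@Finite_rankS _ _ (e' \o f) S (h \o f) i) => //; first exact: IH.
by move=> x; rewrite gE eE.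
Qed.

Lemma finite_rankD X (e f g : {linear X -> X}) :
  finite_rank e -> finite_rank f -> (forall x, g x = e x + f x) -> finite_rank g.
Proof.
move=> fe ff; elim: ff g => [{}f f0|{}f f' S h i sS _ IH fE] g gE.
  by apply: (finite_rank_comp (f := idfun) fe) => x; rewrite gE f0 addr0.
apply: (@Finite_rankS _ _ (e \+ f') S h i) => //; first exact: IH.
by move=> x; rewrite gE fE addrA.
Qed.

Lemma finite_rank_fix X (s : seq X) : killed X ->
  exists2 e : {linear X -> X}, finite_rank e & forall x, x \in s -> e x = x.
Proof.
move=> kX.
have comb (e e' : {linear X -> X}) : finite_rank e -> finite_rank e' ->
    exists2 g : {linear X -> X}, finite_rank g & forall x, g x = e x + e' (x - e x).
  move=> fe fe'; pose c : {linear X -> X} := e' \o (idfun \- e).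
  exists (e \+ c) => //.
  by apply: (finite_rankD fe (finite_rank_comp (g := c) (f := idfun \- e) fe' _)).
(* Quantifying over f makes D closed under sums: after e fixes f x, the condition on y is used for f
   - e f, and [comb] merges the two maps. *)
pose D x := forall f : {linear X -> X}, exists2 e : {linear X -> X},
  finite_rank e & e (f x) = f x.
have sD : submod D.
  split=> [f|a x y Dx Dy f].
    by exists \0; [exact: Finite_rank0|rewrite !linear0].
  have [e fe eE] := Dx f.
  have [e' fe' eE'] := Dy (f \- (e \o f)).
  have [g fg gE] := comb _ _ fe fe'; exists g => //.
  have gx : g (f x) = f x by rewrite gE eE subrr linear0 addr0.
  have gy : g (f y) = f y by rewrite gE eE' addrC subrK.
  by rewrite linearP [LHS]linearP gx gy.
have DX : forall x, D x.
  apply: (killed_socle kX sD) => S i sS y f.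
  have [fy|/eqP fy] := eqVneq (f (i y)) 0.
    by exists \0; [exact: Finite_rank0|rewrite fy linear0].
  have fi : injective (f \o i) := simple_inj (h := f \o i) sS fy.
  have [r rP] := killed_retraction ssA kX fi.
  exists ((f \o i) \o r) => /=; last by have /= -> := rP y.
  apply: (@Finite_rankS _ _ \0 S r (f \o i)) => //; first exact: Finite_rank0.
  by move=> x; rewrite /= add0r.
elim: s => [|x s [e fe es]]; first by exists \0; [exact: Finite_rank0|].
have [e' fe' eE'] := DX x (idfun \- e).
have [g fg gE] := comb _ _ fe fe'; exists g => // y; rewrite inE => /predU1P[->|ys].
  by rewrite gE; have /= -> := eE'; rewrite addrC subrK.
by rewrite gE es // subrr linear0 addr0.
Qed.

End Semiprimary.
End Simple.

(** * Minimal projective covers *)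

Section MinimalCover.
Variable A : pzRingType.
Implicit Types M N L X Y S T P Q : lmodType A.
Local Notation J := (jacobson A).

Lemma free_ext_uniq (X : choiceType) M (g h : {linear free_module A X -> M}) :
  (forall x, g (free_delta A x) = h (free_delta A x)) -> forall f, g f = h f.
Proof.
move=> gh f; rewrite -[f]free_decomp 2!free_ext_comp.
by congr (free_ext_fun _ f); exact/funext.
Qed.

Lemma projective_retract P Q (i : {linear P -> Q}) (r : {linear Q -> P}) :
  (forall x, r (i x) = x) -> projective_module Q -> projective_module P.
Proof.
move=> ri pQ M N g f gs; have [h hP] := pQ M N g (f \o r) gs.
by exists (h \o i) => x; rewrite hP /= ri.
Qed.

Hypothesis ssA : semisimple_ring (jacobson_quotient A).
Hypothesis J3 : forall x y z : A, x \in J -> y \in J -> z \in J -> x * y * z = 0.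

Lemma rad_nilpotent M N1 N2 N3 (f : {linear M -> N1}) (g : {linear N1 -> N2})
    (h : {linear N2 -> N3}) :
  (forall x, rad (f x)) -> (forall x, rad (g x)) -> (forall x, rad (h x)) ->
  forall x, h (g (f x)) = 0.
Proof.
move=> fr gr hr x; have : rad2 (g (f x)) by exact: rad_to_rad2.
move: (g (f x)); apply: rad2_ind => [|j y jJ ry].
  exact: (submod_preim h (submod_eq0 N3)).
by rewrite linearZ; apply: (scale_rad2 J3) => //; exact: rad_to_rad2.
Qed.

(* The projection of F/JF onto the image of the kernel of F -> M lifts to an   *)
(* endomorphism e of the free module F which is idempotent modulo JF. On the   *)
(* image of e^3 the map e is invertible with inverse t = 1 + u + u^2 for       *)
(* u = 1 - e, because (eu)^3 = 0; hence t^3 e^3 is an idempotent.              *)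
Lemma minimal_cover_exists M : exists P (p : {linear P -> M}),
  [/\ projective_module P, forall y, exists x, p x = y &
      forall x, p x = 0 -> rad x].
Proof.
pose F := free_module A M.
have [c cs] : exists c : {linear F -> M}, forall y, exists x, c x = y.
  by exists (free_counit M); exact: free_counit_surj.
have [T [q [qs q0]]] := quotientP (@rad_submod A F).
have kT := killed_quotient qs q0.
have [p0 [p0im p0id]] := killed_projection ssA kT
  (submod_im q (submod_preim c (submod_eq0 M))).
pose k x := s2val (cid2 (p0im (q (free_delta A x)))).
have kP x : c (k x) = 0 /\ q (k x) = p0 (q (free_delta A x)).
  by rewrite /k; case: cid2.
have [e eE] : exists e : {linear F -> F},
    forall x, e (free_delta A x) = free_delta A x - k x.
  exists (free_ext (fun x : M => free_delta A x - k x)) => x.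
  by rewrite free_ext_delta.
have ce y : c (e y) = c y.
  apply: (free_ext_uniq (g := c \o e) (h := c)) => x /=.
  by rewrite eE linearB (kP x).1 subr0.
have qe y : q (e y) = q y - p0 (q y).
  apply: (free_ext_uniq (g := q \o e) (h := q \- (p0 \o q))) => x /=.
  by rewrite eE linearB (kP x).2.
have [u uE] : exists u : {linear F -> F}, forall y, u y = y - e y.
  by exists (idfun \- e).
have ue y : u (e y) = e (u y) by rewrite !uE linearB.
have [t tE] : exists t : {linear F -> F}, forall y, t y = y + u y + u (u y).
  by exists (idfun \+ u \+ (u \o u)).
have qB x y : q (x - y) = q x - q y by exact: linearB.
have p0B x y : p0 (x - y) = p0 x - p0 y by exact: linearB.
have uB x y : u (x - y) = u x - u y by exact: linearB.
have te y : t (e y) = e (t y) by rewrite !tE !ue !linearD.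
have n3 y : u (u (u (e (e (e y))))) = 0.
  have nr z : rad (u (e z)).
    apply/q0; rewrite uE qB (qe (e z)) opprB addrC subrK qe p0B.
    by rewrite (p0id (p0 _)) // subrr.
  have := @rad_nilpotent F F F F (u \o e) (u \o e) (u \o e) nr nr nr y.
  by rewrite /= -!ue.
have te1 y : t (e (e (e (e y)))) = e (e (e y)).
  set w := e (e (e y)); have -> : e (e (e (e y))) = w - u w.
    by rewrite uE opprB addrC subrK.
  have -> : t (w - u w) = w - u (u (u w)).
    by rewrite tE !uB !subrKA.
  by rewrite n3 subr0.
have [r rE] : exists r : {linear F -> F}, forall y, r y = t (t (t (e (e (e y))))).
  by exists (t \o t \o t \o e \o e \o e).
have r3 y : r (e (e (e y))) = e (e (e y)) by rewrite rE !te1.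
have rr y : r (r y) = r y by rewrite [r y]rE !te r3.
pose d : {linear F -> F} := idfun \- r.
have dE y : d y = y - r y by [].
have [s sE] : exists s : {linear F -> kernel_module d}, forall y, val (s y) = r y.
  by apply: (kernel_lift (f := d) (g := r)) => y; rewrite dE rr subrr.
have sK (w : kernel_module d) : s (val w) = w.
  apply/val_inj; rewrite sE; apply/eqP; rewrite eq_sym -subr_eq0 -dE.
  by rewrite kernel_mem.
have cu y : c (u y) = 0 by rewrite uE linearB ce subrr.
have cr y : c (r y) = c y by rewrite rE !tE !linearD !cu !addr0 !ce.
exists (kernel_module d), (c \o kernel_incl d); split.
- apply: (@projective_retract _ F (kernel_incl d) s sK).
  exact: free_module_projective.
- move=> y; have [x cx] := cs y; exists (s x).
  by rewrite /= sE cr.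
- move=> w /= cw; have ew : rad (e (val w)).
    by apply/q0; rewrite qe p0id ?subrr //; exists (val w).
  have rw : rad (r (val w)).
    by do 2![have {}ew := rad_map e ew]; do 3![have {}ew := rad_map t ew]; rewrite rE.
  have e1 : r (val w) = val w by rewrite -sE sK.
  by rewrite -[w]sK; apply: rad_map; rewrite -e1.
Qed.

End MinimalCover.

(** * Stable retracts of syzygies and Ext *)

Section Presentations.
Variable A : pzRingType.
Implicit Types M N L X Y S T P Q : lmodType A.

(* 0 -> syz -> cov -> M -> 0 exact with cov projective.                       *)
Record presentation M := Presentation {
  cov : lmodType A;
  syz : lmodType A;
  cov_map : {linear cov -> M};
  syz_incl : {linear syz -> cov};
  cov_projective : projective_module cov;
  cov_surj : forall y, exists x, cov_map x = y;
  syz_inj : injective syz_incl;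
  syz_exact : forall x, cov_map x = 0 <-> exists w, syz_incl w = x
}.

(** Transparent, so that the syzygy of [free_presentation] is convertible with the next canonical
    [syzygy]. *)
Definition kernel_presentation M P (p : {linear P -> M})
    (pP : projective_module P) (ps : forall y, exists x, p x = y) : presentation M.
Proof.
refine (@Presentation M P (kernel_module p) p (kernel_incl p) pP ps _ _).
  exact: val_inj.
move=> x; split=> [/kernel_elt[w wx]|[w <-]]; last exact: kernel_mem.
by exists w.
Defined.

Lemma cov_map_incl M (p : presentation M) w : cov_map p (syz_incl p w) = 0.
Proof. by apply/syz_exact; exists w. Qed.

Lemma syz_factor M Y (p : presentation M) (g : {linear Y -> cov p}) :
  (forall y, cov_map p (g y) = 0) ->
  exists h : {linear Y -> syz p}, forall y, syz_incl p (h y) = g y.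
Proof.
by move=> pg; apply: factor_inj => [|y]; [exact: syz_inj|exact/syz_exact].
Qed.

Lemma syz_restrict M N (p : presentation M) (p' : presentation N)
    (f : {linear M -> N}) (F : {linear cov p -> cov p'}) :
  (forall x, cov_map p' (F x) = f (cov_map p x)) ->
  exists f1 : {linear syz p -> syz p'},
    forall w, syz_incl p' (f1 w) = F (syz_incl p w).
Proof.
move=> FE; apply: (syz_factor (g := F \o syz_incl p)) => w.
by rewrite /= FE cov_map_incl linear0.
Qed.

Lemma cov_lift M N (p : presentation M) (p' : presentation N) (f : {linear M -> N}) :
  exists F : {linear cov p -> cov p'}, forall x, cov_map p' (F x) = f (cov_map p x).
Proof.
exact: (@cov_projective _ p _ _ (cov_map p') (f \o cov_map p) (@cov_surj _ p')).
Qed.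

Definition null M N (f : {linear M -> N}) : Prop :=
  exists Q (a : {linear M -> Q}) (b : {linear Q -> N}),
    projective_module Q /\ forall x, f x = b (a x).

(** If f = b a through a projective module, lift b to b' into the cover of N. Subtracting b' a from
    F leaves a map into the syzygy that agrees with F on the syzygy of M. *)
Lemma null_lift M N (p : presentation M) (p' : presentation N)
    (f : {linear M -> N}) (F : {linear cov p -> cov p'})
    (f1 : {linear syz p -> syz p'}) :
    null f -> (forall x, cov_map p' (F x) = f (cov_map p x)) ->
    (forall w, syz_incl p' (f1 w) = F (syz_incl p w)) ->
  exists s : {linear cov p -> syz p'}, forall w, f1 w = s (syz_incl p w).
Proof.
move=> [Q [a [b [pQ fE]]]] FE f1E.
have [b' b'E] := pQ _ _ (cov_map p') b (@cov_surj _ p').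
have [|s sE] := syz_factor (p := p') (g := F \- (b' \o a \o cov_map p)).
  by move=> y; rewrite linearB /= b'E FE fE subrr.
exists s => w; apply: (@syz_inj _ p'); rewrite sE /= cov_map_incl !linear0 addr0.
exact: f1E.
Qed.

(** This plays the role of Schanuel's lemma: syzygies from different presentations are compared
    modulo maps through projectives, which the extension property does not detect. *)
Definition stable_retract M N : Prop :=
  exists (u : {linear M -> N}) (v : {linear N -> M}), null (idfun \- (v \o u)).

Lemma isomorphic_stable_retract S T : isomorphic S T -> stable_retract S T.
Proof.
move=> [f [g [gf fg]]]; exists f, g.
exists (free_module A void), \0, \0; split; first exact: free_module_projective.
by move=> x; rewrite /= gf subrr.
Qed.

Lemma stable_retract_lift M N (p : presentation M) (p' : presentation N) :
    stable_retract M N ->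
  exists (u : {linear syz p -> syz p'}) (v : {linear syz p' -> syz p})
    (U : {linear cov p -> cov p'}) (s : {linear cov p -> syz p}),
    (forall w, syz_incl p' (u w) = U (syz_incl p w)) /\
    (forall w, w - v (u w) = s (syz_incl p w)).
Proof.
move=> [u [v n]]; have [U UE] := cov_lift p p' u; have [V VE] := cov_lift p' p v.
have [u1 u1E] := syz_restrict UE; have [v1 v1E] := syz_restrict VE.
have [||s sE] := null_lift (p := p) (p' := p) (F := idfun \- (V \o U))
    (f1 := idfun \- (v1 \o u1)) n.
- by move=> x; rewrite linearB /= VE UE.
- by move=> w; rewrite linearB /= v1E u1E.
by exists u1, v1, U, s.
Qed.

Lemma stable_retract_syz M N (p : presentation M) (p' : presentation N) :
  stable_retract M N -> stable_retract (syz p) (syz p').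
Proof.
move=> /(stable_retract_lift p p')[u [v [U [s [_ sE]]]]]; exists u, v.
by exists (cov p), (syz_incl p), s; split; [exact: cov_projective|].
Qed.

(* When p presents an n-th syzygy of N, this says that Ext^(n+1)(N, T) = 0.    *)
Definition extension_property M (p : presentation M) T : Prop :=
  forall f : {linear syz p -> T}, exists g : {linear cov p -> T},
    forall w, g (syz_incl p w) = f w.

Lemma extension_property_retract M N (p : presentation M) (p' : presentation N) T :
  stable_retract M N -> extension_property p' T -> extension_property p T.
Proof.
move=> /(stable_retract_lift p p')[u [v [U [s [UE sE]]]]] ep' f.
have [g gE] := ep' (f \o v); exists ((g \o U) \+ (f \o s)) => w /=.
by rewrite -UE gE -sE /= linearB addrC subrK.
Qed.

Definition free_presentation M : presentation M :=
  kernel_presentation (p := free_counit M) (@free_module_projective A _)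
    (@free_counit_surj A M).

Lemma Ext_extension M T n :
  (forall x : Ext n.+1 M T, x = 0) <->
  extension_property (free_presentation (syzygy M n)) T.
Proof.
split=> [/cohomology0P H f|H]; last apply/cohomology0P.
  have [] := H (f \o free_counit (syzygy M n.+1)).
    split; first exact: linearP.
    move=> x; have dx : free_counit (syzygy M n.+1) (free_res_diff M n.+1 x) = 0.
      by apply/free_res_diff_image; exists x.
    rewrite -[LHS]/(f (free_counit (syzygy M n.+1) (free_res_diff M n.+1 x))).
    by rewrite dx linear0.
  move=> g gE; exists g => w.
  have [y <-] := free_counit_surj w; exact/esym/gE.
move=> f [lf fd].
have [|h hE] := factor_surj (q := free_counit (syzygy M n.+1))
    (f := linear_of_linear lf) (@free_counit_surj _ _).
  by move=> x qx; have [y <-] := (@free_res_diff_image A M n.+1 x).1 qx; exact: fd.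
have [g gE] := H h; exists g => x.
by rewrite -[f x]/(linear_of_linear lf x) -hE -gE.
Qed.

End Presentations.

(** * Finite support of elements of a projective cover *)

Section Support.
Variable A : pzRingType.
Implicit Types M N : lmodType A.

(** The projective cover is a retract of the free module on its elements, where each element of s
    involves only finitely many basis vectors; s' consists of their images in M. *)
Lemma cov_support M (p : presentation M) (s : seq (cov p)) :
  exists s' : seq M, forall N (p' : presentation N) (f : {linear M -> N}),
    (forall x, x \in s' -> f x = 0) ->
    exists F : {linear cov p -> cov p'},
      (forall x, cov_map p' (F x) = f (cov_map p x)) /\
      (forall y, y \in s -> F y = 0).
Proof.
have [a aE] : exists a : {linear cov p -> free_module A (cov p)},
    forall x, free_counit (cov p) (a x) = x.
  exact: (@cov_projective _ _ p _ _ (free_counit (cov p)) idfun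
    (@free_counit_surj _ _)).
have [t tE] : exists t : seq (cov p), forall y, y \in s ->
    forall x, x \notin t -> fcoef (a y) x = 0.
  elim: s => [|y s [t tE]]; first by exists [::].
  have /finsuppP[t' t'E] := valP (a y); exists (t' ++ t) => y'.
  rewrite inE => /predU1P[->|ys] x; rewrite mem_cat negb_or => /andP[xt' xt].
    exact: t'E.
  exact: tE.
exists [seq cov_map p x | x <- t] => N p' f f0.
(* Choosing the preimage 0 wherever f vanishes is what makes the lift kill s. *)
pose c x := if f (cov_map p x) == 0 then 0
            else sval (cid (@cov_surj _ _ p' (f (cov_map p x)))).
have cE x : cov_map p' (c x) = f (cov_map p x).
  by rewrite /c; case: eqP => [->|_]; [exact: linear0|case: cid].
exists (free_ext c \o a); split=> [x|y ys].
  rewrite -[in RHS](aE x).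
  apply: (free_ext_uniq (g := cov_map p' \o free_ext c)
                        (h := f \o cov_map p \o free_counit (cov p))) => y.
  rewrite -[LHS]/(cov_map p' (free_ext c (free_delta A y))).
  rewrite -[RHS]/(f (cov_map p (free_counit (cov p) (free_delta A y)))).
  by rewrite !free_ext_delta cE.
rewrite -[LHS]/(free_ext_fun c (a y)) (free_extE _ (tE y ys)) big_seq big1 // => x.
rewrite mem_undup => xt; rewrite /c f0 ?eqxx ?scaler0 //.
exact: map_f.
Qed.

End Support.

(** * Lifting maps along minimal resolutions *)

Section MinimalResolution.
Variable A : pzRingType.
Local Notation J := (jacobson A).
Hypothesis ssA : semisimple_ring (jacobson_quotient A).
Hypothesis J3 : forall x y z : A, x \in J -> y \in J -> z \in J -> x * y * z = 0.
Implicit Types M N L X Y S T P Q : lmodType A.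

Lemma minimal_presentation_exists M :
  exists p : presentation M, forall w, rad (syz_incl p w).
Proof.
have [P [p [pP ps pr]]] := minimal_cover_exists ssA J3 M.
exists (kernel_presentation pP ps) => w; apply: pr; exact: kernel_mem.
Qed.

Definition minpres M : presentation M := sval (cid (minimal_presentation_exists M)).
Local Notation PC M := (cov (minpres M)).
Local Notation omega M := (syz (minpres M)).
Local Notation cm M := (cov_map (minpres M)).
Local Notation oi M := (syz_incl (minpres M)).

Lemma rad_oi M w : rad (oi M w).
Proof. exact: (svalP (cid (minimal_presentation_exists M))). Qed.

Lemma top_exists M : exists (Q : lmodType A) (q : {linear M -> Q}),
  (forall y, exists x, q x = y) /\ (forall x, q x = 0 <-> rad x).
Proof. exact/quotientP/rad_submod. Qed.

Definition top M : lmodType A := sval (cid (top_exists M)).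
Definition topq M : {linear M -> top M} := sval (cid (svalP (cid (top_exists M)))).

Lemma topq_surj M y : exists x, topq M x = y.
Proof. exact: (svalP (cid (svalP (cid (top_exists M))))).1. Qed.

Lemma topq0 M x : topq M x = 0 <-> rad x.
Proof. exact: (svalP (cid (svalP (cid (top_exists M))))).2. Qed.

Lemma killed_top M : killed (top M).
Proof. exact: killed_quotient (@topq_surj M) (@topq0 M). Qed.

(** The first syzygy is innermost, so that [lift], [linear_zero] and [reach] can recurse by
    replacing M with its first syzygy. *)
Fixpoint Om n M : lmodType A := if n is n'.+1 then Om n' (omega M) else M.

Lemma OmS n M : Om n.+1 M = omega (Om n M).
Proof. by elim: n M => [//|n IH] M; rewrite -[RHS]/(omega (Om n (omega M))) -IH. Qed.

Definition lift1 M N (f : {linear M -> N}) (f1 : {linear omega M -> omega N}) : Prop :=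
  exists F : {linear PC M -> PC N},
    (forall x, cm N (F x) = f (cm M x)) /\ (forall w, oi N (f1 w) = F (oi M w)).

Fixpoint lift n M N : {linear M -> N} -> {linear Om n M -> Om n N} -> Prop :=
  match n return {linear M -> N} -> {linear Om n M -> Om n N} -> Prop with
  | 0 => fun f g => forall x, g x = f x
  | n'.+1 => fun f g => exists f1, lift1 f f1 /\ @lift n' (omega M) (omega N) f1 g
  end.

Lemma lift1_exists M N (f : {linear M -> N}) : exists f1, lift1 f f1.
Proof.
have [F FE] := cov_lift (minpres M) (minpres N) f.
by have [f1 f1E] := syz_restrict FE; exists f1, F.
Qed.

Lemma lift1_comp M N L (f : {linear M -> N}) (g : {linear N -> L}) f1 g1 :
  lift1 f f1 -> lift1 g g1 -> lift1 (g \o f) (g1 \o f1).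
Proof.
move=> [F [FE f1E]] [G [GE g1E]]; exists (G \o F); split=> x /=.
  by rewrite GE FE.
by rewrite g1E f1E.
Qed.

Lemma lift1D M N (f g : {linear M -> N}) f1 g1 :
  lift1 f f1 -> lift1 g g1 -> lift1 (f \+ g) (f1 \+ g1).
Proof.
move=> [F [FE f1E]] [G [GE g1E]]; exists (F \+ G); split=> x /=.
  by rewrite linearD FE GE.
by rewrite linearD f1E g1E.
Qed.

Lemma lift1B M N (f g : {linear M -> N}) f1 g1 :
  lift1 f f1 -> lift1 g g1 -> lift1 (f \- g) (f1 \- g1).
Proof.
move=> [F [FE f1E]] [G [GE g1E]]; exists (F \- G); split=> x /=.
  by rewrite linearB FE GE.
by rewrite linearB f1E g1E.
Qed.

Lemma lift_ext n M N (f f' : {linear M -> N}) g :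
  (forall x, f x = f' x) -> lift f g -> lift (n := n) f' g.
Proof.
case: n g => [|n] g ff' /=; first by move=> gE x; rewrite gE.
move=> [f1 [[F [FE f1E]] l]]; exists f1; split=> //.
by exists F; split=> // x; rewrite FE.
Qed.

Lemma lift_exists n M N (f : {linear M -> N}) : exists g, lift (n := n) f g.
Proof.
elim: n M N f => [|n IH] M N f; first by exists f.
have [f1 ff1] := lift1_exists f; have [g fg] := IH _ _ f1.
by exists g, f1.
Qed.

Lemma lift_comp n M N L (f : {linear M -> N}) (g : {linear N -> L}) f' g' :
  lift f f' -> lift g g' -> lift (n := n) (g \o f) (g' \o f').
Proof.
elim: n M N L f g f' g' => [|n IH] M N L f g f' g' /=.
  by move=> fE gE x; rewrite fE gE.
move=> [f1 [ff1 f1f']] [g1 [gg1 g1g']]; exists (g1 \o f1).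
by split; [exact: lift1_comp|exact: IH].
Qed.

Lemma liftD n M N (f g : {linear M -> N}) f' g' :
  lift f f' -> lift g g' -> lift (n := n) (f \+ g) (f' \+ g').
Proof.
elim: n M N f g f' g' => [|n IH] M N f g f' g' /=.
  by move=> fE gE x; rewrite fE gE.
move=> [f1 [ff1 f1f']] [g1 [gg1 g1g']]; exists (f1 \+ g1).
by split; [exact: lift1D|exact: IH].
Qed.

Lemma liftB n M N (f g : {linear M -> N}) f' g' :
  lift f f' -> lift g g' -> lift (n := n) (f \- g) (f' \- g').
Proof.
elim: n M N f g f' g' => [|n IH] M N f g f' g' /=.
  by move=> fE gE x; rewrite fE gE.
move=> [f1 [ff1 f1f']] [g1 [gg1 g1g']]; exists (f1 \- g1).
by split; [exact: lift1B|exact: IH].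
Qed.

Lemma lift_id n M : lift (n := n) (idfun : {linear M -> M}) idfun.
Proof.
elim: n M => [//|n IH] M; exists idfun; split; last exact: IH.
by exists idfun.
Qed.

Lemma null0 M N (f : {linear M -> N}) : (forall x, f x = 0) -> null f.
Proof.
move=> f0; exists (free_module A void), \0, \0.
by split=> [|x]; [exact: free_module_projective|rewrite f0].
Qed.

Lemma lift1_null M N (f : {linear M -> N}) f1 : null f -> lift1 f f1 ->
  exists s : {linear PC M -> omega N}, forall w, f1 w = s (oi M w).
Proof. by move=> nf [F [FE f1E]]; exact: null_lift nf FE f1E. Qed.

Lemma lift1_null_rad M N (f : {linear M -> N}) f1 w :
  null f -> lift1 f f1 -> rad (f1 w).
Proof.
by move=> nf /(lift1_null nf)[s sE]; rewrite sE; apply: rad_map; exact: rad_oi.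
Qed.

(** A lift of a null map to first syzygies factors through the inclusion of the syzygy into its
    cover. So it is null again, and its image is radical because that inclusion has radical
    image. *)
Lemma lift_null n M N (f : {linear M -> N}) g z :
  null f -> lift (n := n.+1) f g -> rad (g z).
Proof.
elim: n M N f g z => [|n IH] M N f g z nf [f1 [ff1 f1g]].
  by rewrite f1g; exact: lift1_null_rad ff1.
apply: IH f1g; have [s sE] := lift1_null nf ff1.
by exists (PC M), (oi M), s; split; first exact: cov_projective.
Qed.

Lemma lift0_rad n M N (f : {linear M -> N}) g z :
  (forall x, f x = 0) -> lift (n := n) f g -> rad (g z).
Proof.
case: n g z => [|n] g z f0 fg; last exact: lift_null (null0 f0) fg.
by rewrite fg f0; case: (@rad_submod A N).
Qed.

Lemma Om_support n M (z : Om n M) :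
  exists s : seq M, forall N (f : {linear M -> N}), (forall x, x \in s -> f x = 0) ->
    exists2 g, lift f g & g z = 0.
Proof.
elim: n M z => [|n IH] M z.
  by exists [:: z] => N f f0; exists f => //; apply: f0; rewrite inE.
have [s sP] := IH _ z; have [s' s'P] := cov_support (map (oi M) s).
exists s' => N f f0; have [F [FE F0]] := s'P N (minpres N) f f0.
have [f1 f1E] := syz_restrict FE; have [|g f1g gz] := sP _ f1.
  move=> x xs; apply: (@syz_inj _ _ (minpres N)); rewrite f1E linear0.
  by apply/F0/map_f.
by exists g => //; exists f1; split=> //; exists F.
Qed.

(* Lifts of a map f : X -> Y to the n-th syzygies are not unique, but they     *)
(* induce a well-defined map Om n X / bad -> Om n Y / bad.                     *)
Definition subfunctor (bad : forall n X, Om n X -> Prop) : Prop :=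
  [/\ forall n X (z z' : Om n X), bad n X z -> bad n X z' -> bad n X (z + z'),
      forall n X Y (f : {linear X -> Y}) g z,
        (forall x, f x = 0) -> lift (n := n) f g -> bad n Y (g z) &
      forall n X Y (f : {linear X -> Y}) g z,
        lift (n := n) f g -> bad n X z -> bad n Y (g z)].

(* The quotient is Tor_n(A/J, X) here, whatever n > 0 and X.                   *)
Lemma subfunctor_rad : subfunctor (fun n X z => rad z).
Proof.
split=> [n X z z'|n X Y f g z|n X Y f g z _]; last exact: rad_map.
  by apply: submodD; exact: rad_submod.
exact: lift0_rad.
Qed.

(* For X semisimple and R = A/J^2, this is the kernel of the map from the n-th *)
(* syzygy of X over A to the one over R, which is J/J^2 (x) ... (x) J/J^2 (x) X. *)
Fixpoint linear_zero n X : Om n X -> Prop :=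
  match n return Om n X -> Prop with
  | 0 => fun z => z = 0
  | n'.+1 => fun z => exists H, lift (topq (omega X)) H /\
      @linear_zero n' (top (omega X)) (H z)
  end.

(** The three clauses are proved together: independence of the chosen lift ([IHB]) uses the first
    two in the lower degree. A lift of 0 to first syzygies has radical image, hence induces 0 on
    tops. *)
Lemma subfunctor_linear_zero : subfunctor linear_zero.
Proof.
suff key n : [/\ forall X (z z' : Om n X), linear_zero z -> linear_zero z' ->
        linear_zero (z + z'),
      forall X Y (f : {linear X -> Y}) g z,
        (forall x, f x = 0) -> lift (n := n) f g -> linear_zero (g z) &
      forall X Y (f : {linear X -> Y}) g z,
        lift (n := n) f g -> linear_zero z -> linear_zero (g z)].
  by split=> n; case: (key n).
elim: n => [|n [IHD IH0 IHf]].
  split=> [X z z' /= -> ->|X Y f g z f0 /= ->|X Y f g z /= fg ->].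
  - by rewrite addr0.
  - exact: f0.
  - by rewrite linear0.
have IHB X Y (f : {linear X -> Y}) g g' z :
    lift (n := n) f g -> lift f g' -> linear_zero (g z) -> linear_zero (g' z).
  move=> fg fg' gz; have -> : g' z = g z + (g' \- g) z by rewrite /= addrC subrK.
  apply: IHD => //; apply: (IH0 _ _ (f \- f)); last exact: liftB.
  by move=> x /=; rewrite subrr.
split.
- move=> X z z' [H [lH Hz]] [H' [lH' Hz']]; exists H; split=> //.
  by rewrite linearD; apply: IHD => //; exact: IHB lH' lH Hz'.
- move=> X Y f g z f0 [f1 [ff1 f1g]].
  have [H lH] := lift_exists n (topq (omega Y)); exists H; split=> //.
  apply: (IH0 _ _ (topq (omega Y) \o f1) (H \o g)); last exact: lift_comp.
  by move=> w; apply/topq0; exact: lift1_null_rad (null0 f0) ff1.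
- move=> X Y f g z [f1 [ff1 f1g]] [H [lH Hz]].
  have [f2 f2E] : exists f2 : {linear top (omega X) -> top (omega Y)},
      forall w, f2 (topq (omega X) w) = topq (omega Y) (f1 w).
    apply: (factor_surj (f := topq (omega Y) \o f1)); first exact: topq_surj.
    by move=> w /topq0 rw; apply/topq0; exact: rad_map.
  have [G lG] := lift_exists n f2.
  have [K lK] := lift_exists n (topq (omega Y)); exists K; split=> //.
  apply: (IHB _ _ (topq (omega Y) \o f1) (G \o H) (K \o g)).
  + by apply: lift_ext (lift_comp lH lG).
  + exact: lift_comp.
  + exact: IHf lG Hz.
Qed.

(** Otherwise every finite-rank e sends z to a bad element. Choose e fixing the finite support of z:
    then 1 - e has a lift killing z, so z is a sum of bad elements. *)
Lemma select_simple (bad : forall n X, Om n X -> Prop) n X (z : Om n X) :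
    subfunctor bad -> killed X -> ~ bad n X z ->
  exists S (h : {linear X -> S}) H,
    [/\ simple_module S, lift h H & ~ bad n S (H z)].
Proof.
move=> [badD bad0 badf] kX nz; apply: contrapT => nS.
have hS S (h : {linear X -> S}) H : simple_module S -> lift h H -> bad n S (H z).
  by move=> sS lH; apply: contrapT => nH; apply: nS; exists S, h, H.
have fin (e : {linear X -> X}) : finite_rank e ->
    forall E, lift e E -> bad n X (E z).
  elim=> {}e => [e0|e' S h i sS _ IH eE] E lE; first exact: bad0 lE.
  have [E' lE'] := lift_exists n e'.
  have [H lH] := lift_exists n h; have [I lI] := lift_exists n i.
  have -> : E z = (E' z + I (H z)) + (E \- (E' \+ (I \o H))) z.
    by rewrite /= addrC subrK.
  apply: (badD); first by apply: (badD); [exact: IH|exact: badf lI (hS _ _ _ sS lH)].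
  apply: (bad0 _ _ _ (e \- (e' \+ (i \o h)))).
    by move=> x /=; rewrite eE subrr.
  by apply: liftB => //; apply: liftD => //; exact: lift_comp.
have [s sP] := Om_support z; have [e fe eE] := finite_rank_fix ssA s kX.
have [E lE] := lift_exists n e.
have [|D lD Dz] := sP _ (idfun \- e); first by move=> x xs; rewrite /= eE ?subrr.
apply: nz; have -> : z = E z + (idfun \- (E \+ D)) z.
  by rewrite /= Dz addr0 addrC subrK.
apply: badD; first exact: fin lE.
apply: (bad0 _ _ _ (idfun \- (e \+ (idfun \- e)))).
  by move=> x /=; rewrite [e x + _]addrC subrK subrr.
by apply: liftB; [exact: lift_id|exact: liftD].
Qed.

(* [reach z w] for z in Om n X and w in Om l N says that n = d + l and that a   *)
(* lift of some map Om d X -> N sends z to w. Spelling it out would need       *)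
(* transports along Om n X = Om l (Om d X).                                   *)
Inductive reach : forall n X, Om n X -> forall l N, Om l N -> Prop :=
| Reach_map n X N (f : {linear X -> N}) H (z : Om n X) of
    lift f H : reach z (H z)
| Reach_step n X (z : Om n (omega X)) l N (w : Om l N) of
    reach z w : @reach n.+1 X z l N w.

Lemma reach_lift n X Y (f : {linear X -> Y}) H (z : Om n X) l N (w : Om l N) :
  lift f H -> reach (H z) w -> reach z w.
Proof.
move=> lH r; move: {-2}(H z) r (erefl (H z)) => y r yE.
elim: r X f H z lH yE => {n Y l N w y} [n Y N g G y lG|n Y y l N w r IH] X f H z lH yE.
  by rewrite -yE; exact: (Reach_map z (lift_comp lH lG)).
by move: lH => [f1 [_ lH1]]; apply: Reach_step; exact: IH lH1 yE.
Qed.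

Lemma reach_trans n X (z : Om n X) l N (w : Om l N) k T (t : Om k T) :
  reach z w -> reach w t -> reach z t.
Proof.
elim=> {n X z l N w} [n X N f H z lH|n X z l N w _ IH] wt.
  exact: reach_lift lH wt.
by apply: Reach_step; exact: IH.
Qed.

Lemma reach_map_neq0 (bad : forall n X, Om n X -> Prop)
    n X (z : Om n X) l N (w : Om l N) :
    subfunctor bad -> reach z w -> ~ bad l N w ->
  exists d (h : {linear Om d X -> N}) x, n = (d + l)%N /\ h x <> 0.
Proof.
move=> [_ bad0 _]; elim=> {n X z l N w} [n X N f H z lH|n X z l N w _ IH] nw.
  exists 0, f; apply: contrapT => f0; apply: nw; apply: bad0 lH => x.
  by apply: contrapT => fx; apply: f0; exists x.
by have [d [h [x [-> hx]]]] := IH nw; exists d.+1, h, x.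
Qed.

Lemma stable_retract_Om n M : stable_retract (Om n M) (syzygy M n).
Proof.
elim: n => [|n IH].
  by apply: isomorphic_stable_retract; exists idfun, idfun.
rewrite OmS; exact: (stable_retract_syz (minpres (Om n M)) (free_presentation _) IH).
Qed.

(** By vanishing of Ext, h extends to the cover of the n-th syzygy; the syzygy sits in the radical
    of that cover, and maps to a semisimple module kill the radical. *)
Lemma Ext_Om_map0 n M T (h : {linear Om n.+1 M -> T}) x :
  (forall c : Ext n.+1 M T, c = 0) -> killed T -> h x = 0.
Proof.
move=> /Ext_extension ep kT; move: h x; rewrite OmS => h x.
have [g gE] := extension_property_retract (p := minpres (Om n M))
  (stable_retract_Om n M) ep h.
by rewrite -gE; apply: (killed_rad kT); apply: rad_map; exact: rad_oi.
Qed.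

(** * Chains of simple modules under the vanishing of self-extensions *)

Section Chains.
Variable m : nat.
Hypothesis m_gt0 : (0 < m)%N.
Hypothesis Ext_self : forall S, simple_module S ->
  forall n, (m <= n)%N -> forall c : Ext n S S, c = 0.

(** Each step lowers the degree by at least 1 and at most B, so starting at degree B v m, where v
    bounds the number of simple classes, v m steps are possible. Two of the v + 1 terms at multiples
    of m are isomorphic; they are at least m degrees apart and joined by a nonzero map from a syzygy
    of the first to the second. *)
Lemma chain_bound (bad : forall n X, Om n X -> Prop) B : subfunctor bad ->
    (forall n S (z : Om n S), simple_module S -> ~ bad n S z -> (B <= n)%N ->
      exists l T (w : Om l T),
        [/\ simple_module T, ~ bad l T w, reach z w & (l < n <= l + B)%N]) ->
  exists b, forall n X (z : Om n X), killed X -> (b <= n)%N -> bad n X z.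
Proof.
move=> sb step; have [v [L LP]] := finitely_many_simples ssA J3.
exists (B * (v * m))%N => n X z kX nB; apply: contrapT => nz.
have [S0 [h0 [H0 [sS0 _ nH0]]]] := select_simple sb kX nz.
pose state := {n : nat & {S : lmodType A & Om n S}}.
pose deg (s : state) := projT1 s; pose mod_ (s : state) := projT1 (projT2 s).
pose elt (s : state) : Om (deg s) (mod_ s) := projT2 (projT2 s).
pose good s := simple_module (mod_ s) /\ ~ bad _ _ (elt s).
pose R s s' := reach (elt s) (elt s') /\ (deg s' < deg s <= deg s' + B)%N.
(* [next] is total: where no step is available it stays put. *)
have /choice[next nextP] : forall s, exists s',
    good s -> (B <= deg s)%N -> good s' /\ R s s'.
  move=> s; have [[[sS ns] Bs]|ng] := pselect (good s /\ (B <= deg s)%N).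
    have [l [T [w [sT nw rw lB]]]] := step _ _ _ sS ns Bs.
    by exists (existT _ l (existT _ T w)).
  by exists s => gs Bs; case: ng.
pose c i := iter i next (existT _ n (existT _ S0 (H0 z)) : state).
have cP i : (i <= v * m)%N -> good (c i) /\ (B * (v * m - i) <= deg (c i))%N.
  elim: i => [|i IH] iv; first by rewrite subn0.
  have [gi Bi] := IH (ltnW iv).
  have Bdi : (B <= deg (c i))%N.
    by apply: leq_trans Bi; rewrite leq_pmulr // subn_gt0.
  have [gi' [_ /andP[_ dB]]] := nextP _ gi Bdi; split=> //.
  rewrite -(leq_add2r B); apply: leq_trans dB; apply: leq_trans Bi.
  by rewrite -mulnSr subnSK.
have cR i : (i < v * m)%N -> R (c i) (c i.+1).
  move=> iv; have [gi Bi] := cP i (ltnW iv).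
  have Bdi : (B <= deg (c i))%N.
    by apply: leq_trans Bi; rewrite leq_pmulr // subn_gt0.
  by have [] := nextP _ gi Bdi.
have cReach i k : (i + k.+1 <= v * m)%N ->
    reach (elt (c i)) (elt (c (i + k.+1)%N)) /\
    (deg (c (i + k.+1)%N) + k.+1 <= deg (c i))%N.
  elim: k => [|k IH] ik.
    rewrite addn1 in ik *; have [r /andP[d _]] := cR i ik.
    by rewrite addn1.
  rewrite addnS in ik *; have [r d] := IH (ltnW ik).
  have [r' /andP[d' _]] := cR _ ik; split; first exact: reach_trans r r'.
  by apply: leq_trans d; rewrite addnS -addSn leq_add2r.
(* Pigeonhole on the terms at indices 0, m, ..., v m. *)
have /choice[cl clP] : forall i : 'I_v.+1, exists j : 'I_v,
    isomorphic (mod_ (c (i * m)%N)) (L j).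
  move=> i; have [|[sS _] _] := cP (i * m)%N.
    by rewrite leq_mul2r -ltnS ltn_ord orbT.
  by have [j jv iso] := LP _ sS; exists (Ordinal jv).
have ncl : ~ injective cl by move=> /leq_card; rewrite !card_ord ltnn.
apply: ncl => i j; wlog ij : i j / (i <= j)%N.
  by move=> W e; case/orP: (leq_total i j) => [/W->|/W h]; last exact/esym/h.
move=> clij; apply/val_inj/eqP; rewrite /= eqn_leq ij leqNgt; apply/negP => lij.
have mij : (m <= j * m - i * m)%N by rewrite -mulnBl leq_pmull // subn_gt0.
pose k := (j * m - i * m).-1.
have kE : (i * m + k.+1 = j * m)%N.
  by rewrite /k prednK ?(leq_trans m_gt0) // subnKC // leq_mul2r (ltnW lij) orbT.
have jv : (j * m <= v * m)%N by rewrite leq_mul2r -ltnS ltn_ord orbT.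
have [|r d] := cReach (i * m)%N k; first by rewrite kE.
rewrite kE in r d; have [[sS _] _] := cP _ jv.
have [[sSi _] _] := cP _ (leq_trans (leq_mul ij (leqnn m)) jv).
have [[_ nj] _] := cP _ jv.
have [e [h [x [eE hx]]]] := reach_map_neq0 sb r nj.
have [f [g [gf fg]]] : isomorphic (mod_ (c (j * m)%N)) (mod_ (c (i * m)%N)).
  by apply: (isomorphic_trans (clP j)); rewrite -clij; exact/isomorphic_sym/clP.
have me : (m <= e)%N.
  have mk : (m <= k.+1)%N by rewrite /k prednK // (leq_trans m_gt0).
  by apply: leq_trans mk _; rewrite -(leq_add2l (deg (c (j * m)%N))) [leqRHS]addnC -eE.
have e0 : (0 < e)%N := leq_trans m_gt0 me.
case: e e0 me h x hx {eE} => // e _ me h x hx.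
have := Ext_Om_map0 (f \o h) x (Ext_self sSi me) (simple_killed J3 sSi).
by move=> /= fh; apply: hx; rewrite -[h x]gf fh linear0.
Qed.

Lemma linear_zero_bound :
  exists b, forall n X (z : Om n X), killed X -> (b <= n)%N -> linear_zero z.
Proof.
apply: (@chain_bound _ 1 subfunctor_linear_zero) => -[//|n] S z sS nz _.
have [H lH] := lift_exists n (topq (omega S)).
have [|T [h [K [sT lK nK]]]] :=
  select_simple (z := H z) subfunctor_linear_zero (@killed_top _).
  by move=> lz; apply: nz; exists H.
exists n, T, (K (H z)); split=> //; last by rewrite addn1 leqnn andbT.
by apply: Reach_step; apply: (reach_lift lH); exact: (Reach_map _ lK).
Qed.

(* The elements of omega M which lie in J^2 P form a semisimple submodule N    *)
(* containing J (omega M). A complement of J (omega M) in N is a direct        *)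
(* summand of omega M; iN \o pN projects onto it, with kernel K.               *)
Lemma omega_split M : exists (N K : lmodType A)
    (pN : {linear omega M -> N}) (iN : {linear N -> omega M})
    (pK : {linear omega M -> K}) (iK : {linear K -> omega M}),
  [/\ killed N, forall w, w = iN (pN w) + iK (pK w) &
      forall k, rad2 (oi M (iK k)) -> rad k].
Proof.
have sV : submod (fun w => rad2 (oi M w)) by exact/submod_preim/rad2_submod.
have [Q [qV [_ qV0]]] := quotientP sV.
pose V := kernel_module qV; pose iV : {linear V -> omega M} := kernel_incl qV.
have iVr v : rad2 (oi M (iV v)) by apply/qV0; exact: kernel_mem.
have kV : killed V.
  move=> j v jJ; apply/val_inj/(@syz_inj _ _ (minpres M)).
  rewrite -[LHS]/(oi M (j *: iV v)) -[RHS]/(oi M 0) linear0 linearZ.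
  exact: (scale_rad2 J3).
have [r [crc rcr]] := killed_regular ssA (topq (omega M) \o iV) kV (@killed_top _).
pose p : {linear omega M -> omega M} := iV \o r \o topq (omega M).
have pp w : p (p w) = p w by rewrite /= rcr.
have [s sE] : exists s : {linear omega M -> kernel_module p},
    forall w, val (s w) = w - p w.
  by apply: (kernel_lift (g := idfun \- p)) => w; rewrite linearB pp subrr.
exists V, (kernel_module p), (r \o topq (omega M)), iV, s, (kernel_incl p).
split=> // [w|k kr]; first by rewrite -[kernel_incl p _]/(val _) sE addrC subrK.
have [v vE] : exists v : V, val v = val k by apply/kernel_elt/qV0.
have rq0 : r (topq (omega M) (val k)) = 0.
  by apply/val_inj; exact: (kernel_mem k).
have rk : rad (val k).
  apply/topq0; rewrite -vE -[topq _ _]/((topq (omega M) \o iV) v) -crc /=.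
  by rewrite vE rq0 !linear0.
have <- : s (val k) = k by apply/val_inj; rewrite sE kernel_mem subr0.
exact: rad_map.
Qed.

(** The top of L embeds in the semisimple X, and a retraction lifts to G with G F = 1 modulo the
    radical. For x radical, x - G F x is then in J^2 P, and so is G F x. *)
Lemma top_injective_cov L X (f : {linear L -> X}) (F : {linear PC L -> PC X}) x :
    killed X -> (forall x, f x = 0 -> rad x) ->
    (forall x, cm X (F x) = f (cm L x)) ->
  rad x -> rad2 (F x) -> rad2 x.
Proof.
move=> kX f0 FE rx rFx.
have [f' f'E] : exists f' : {linear top L -> X}, forall y, f' (topq L y) = f y.
  apply: factor_surj; first exact: topq_surj.
  by move=> y /topq0 ry; apply: (killed_rad kX); exact: rad_map.
have f'i : injective f'.
  apply: linear_inj0 => t; have [y <-] := topq_surj t.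
  by rewrite f'E => fy; apply/topq0; exact: f0.
have [r rf'] := killed_retraction ssA kX f'i.
have qcs t : exists x, (topq L \o cm L) x = t.
  by have [y <-] := topq_surj t; have [z <-] := @cov_surj _ _ (minpres L) y; exists z.
have [G GE] := @cov_projective _ _ (minpres X) _ _ (topq L \o cm L) (r \o cm X) qcs.
have radB y : rad ((idfun \- (G \o F)) y).
  have : rad (cm L (y - G (F y))).
    apply/topq0; rewrite !linearB /=; move: (GE (F y)) => /= ->.
    by rewrite FE -f'E rf' subrr.
  move=> /(rad_lift (@cov_surj _ _ (minpres L)))[y' ry' y'E].
  have /(@syz_exact _ _ (minpres L))[w wE] : cm L (y - G (F y) - y') = 0.
    by rewrite linearB y'E subrr.
  rewrite -[X in rad X]/(y - G (F y)) -[_ - _](subrK y') -wE.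
  by apply: (submodD (@rad_submod _ _)) => //; exact: rad_oi.
rewrite -[x](subrK (G (F x))); apply: (submodD (@rad2_submod _ _)).
  exact: (rad_to_rad2 radB rx).
exact: rad2_map.
Qed.

(* In terms of L = K_0 and omega K_j = N_(j+1) + K_(j+1) split as above, a     *)
(* class in Tor_n(A/J, L) has a nonzero component either in some               *)
(* Tor_(n-j)(A/J, N_j) with j <= g or in Tor_(n-g)(A/J, K_g), and the          *)
(* hypothesis on f forces K_g = 0.                                             *)
Lemma split_step g L X (f : {linear L -> X}) :
    killed X -> (forall x, f x = 0 -> rad x) ->
    (forall (z : Om g L) H, lift f H -> linear_zero (H z)) ->
  forall n (z : Om n L), (g <= n)%N -> ~ rad z ->
  exists l N (w : Om l N), [/\ killed N, ~ rad w, reach z w & (l < n <= l + g)%N].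
Proof.
elim: g L X f => [|g IH] L X f kX f0 fz n z gn nz.
  have L0 : forall x : L, x = 0.
    by apply: (nakayama J3) => x; apply: f0; exact: (fz x f).
  by case: nz; apply: (lift0_rad (f := idfun) (g := idfun) z L0 (lift_id n L)).
case: n z gn nz => // n z gn nz.
have [N [K [pN [iN [pK [iK [kN wE Kr]]]]]]] := omega_split L.
have [f1 [F [FE f1E]]] := lift1_exists f.
have ff1 : lift1 f f1 by exists F.
have [PN lPN] := lift_exists n pN; have [IN lIN] := lift_exists n iN.
have [PK lPK] := lift_exists n pK; have [IK lIK] := lift_exists n iK.
have zE : rad (z - (IN (PN z) + IK (PK z))).
  apply: (lift0_rad (f := idfun \- ((iN \o pN) \+ (iK \o pK)))
                    (g := idfun \- ((IN \o PN) \+ (IK \o PK)))).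
    by move=> w; rewrite /= {1}(wE w) subrr.
  by apply: liftB; [exact: lift_id|apply: liftD; exact: lift_comp].
have [rN|nN] := pselect (rad (PN z)); last first.
  exists n, N, (PN z); split=> //; last by rewrite ltnSn addnS ltnS leq_addr.
  by apply: Reach_step; exact: (Reach_map _ lPN).
have nK : ~ rad (PK z).
  move=> rK; apply: nz; rewrite -[z](subrK (IN (PN z) + IK (PK z))).
  apply: (submodD (@rad_submod _ _)) => //.
  by apply: (submodD (@rad_submod _ _)); exact: rad_map.
pose f' : {linear K -> top (omega X)} := topq (omega X) \o f1 \o iK.
(* The invariant persists: if k goes to the radical of the syzygy of X, its image in the cover of X
   lies in J^2 P, hence so does k in the cover of L by [top_injective_cov], and K was chosen so that
   such k are radical. *)
have f'0 k : f' k = 0 -> rad k.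
  move=> /topq0 rk; apply: Kr; apply: (top_injective_cov kX f0 FE).
    exact: rad_oi.
  by rewrite -f1E; apply: (rad_to_rad2 _ rk) => w; exact: rad_oi.
have f'z (z' : Om g K) H' : lift f' H' -> linear_zero (H' z').
  move=> lH'; have [I lI] := lift_exists g iK; have [H lH] := lift_exists g f1.
  have [T [lT zT]] : linear_zero (H (I z') : Om g.+1 X).
    by apply: (fz (I z') H); exists f1.
  have [badD bad0 _] := subfunctor_linear_zero.
  have -> : H' z' = T (H (I z')) + (H' \- (T \o H \o I)) z'.
    by rewrite /= addrC subrK.
  apply: badD => //; apply: (bad0 g _ _ (f' \- f')).
    by move=> y; rewrite /= subrr.
  apply: liftB => //; apply: (lift_comp (f := iK) (g := topq (omega X) \o f1)) => //.
  exact: lift_comp.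
have [l [N' [w [kN' nw rw /andP[ln nl]]]]] :=
  IH K _ f' (@killed_top _) f'0 f'z n (PK z) gn nK.
exists l, N', w; split=> //; last by rewrite (leq_trans ln) // addnS ltnS.
by apply: Reach_step; exact: reach_lift lPK rw.
Qed.

(** Beyond degree g linear parts vanish, so [split_step] gives steps of degree at most g and
    [chain_bound] handles semisimple modules. One more [split_step], along M -> [top M], passes to
    arbitrary M at the cost of g further degrees. *)
Lemma Om_eventually0 : exists b, forall n M (z : Om n M), (b <= n)%N -> z = 0.
Proof.
have [g gP] := linear_zero_bound.
have [|b bP] := @chain_bound (fun n X z => rad z) g subfunctor_rad.
  move=> n S z sS nz gn; have kS := simple_killed J3 sS.
  have S0 (x : S) : (idfun : {linear S -> S}) x = 0 -> rad x.
    by move=> /= ->; case: (@rad_submod A S).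
  have Sz (z' : Om g S) (H : {linear Om g S -> Om g S}) :
    lift (idfun : {linear S -> S}) H -> linear_zero (H z') by move=> _; exact: gP.
  have [l [N [w [kN nw rw ln]]]] := split_step kS S0 Sz gn nz.
  have [T [h [H [sT lH nH]]]] := select_simple subfunctor_rad kN nw.
  by exists l, T, (H w); split=> //; apply: (reach_trans rw); exact: (Reach_map _ lH).
exists (g + b)%N => n M z bn; apply: (nakayama J3) => {}z; apply: contrapT => nz.
have M0 x : topq M x = 0 -> rad x by move=> /topq0.
have Mz (z' : Om g M) (H : {linear Om g M -> Om g (top M)}) :
  lift (topq M) H -> linear_zero (H z') by move=> _; apply: gP => //; exact: killed_top.
have [l [N [w [kN nw _ /andP[_ nl]]]]] :=
  split_step (@killed_top M) M0 Mz (leq_trans (leq_addr _ _) bn) nz.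
apply: nw; apply: bP => //.
by rewrite -(leq_add2l g) (leq_trans bn) // addnC.
Qed.

End Chains.

(** Same modules as [Om], but with the last syzygy outermost, so that consecutive terms of the
    resolution fit definitionally. *)
Fixpoint minimal_syzygy n M : lmodType A :=
  if n is n'.+1 then omega (minimal_syzygy n' M) else M.

Lemma minimal_syzygyE n M : minimal_syzygy n M = Om n M.
Proof. by elim: n => [//|n IH]; rewrite OmS -IH. Qed.

Definition minimal_diff M n :
    {linear PC (minimal_syzygy n.+1 M) -> PC (minimal_syzygy n M)} :=
  oi (minimal_syzygy n M) \o cm (minimal_syzygy n.+1 M).

Lemma minimal_diff_image M n x :
  cm (minimal_syzygy n M) x = 0 <-> exists y, minimal_diff M n y = x.
Proof.
split=> [/(@syz_exact _ _ (minpres _))[w <-]|[y <-]]; last exact: cov_map_incl.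
by have [y <-] := @cov_surj _ _ (minpres (minimal_syzygy n.+1 M)) w; exists y.
Qed.

Lemma minimal_diff_exact M n x :
  minimal_diff M n x = 0 <-> exists y, minimal_diff M n.+1 y = x.
Proof.
rewrite -minimal_diff_image; split=> [x0|x0]; last by rewrite /= x0 linear0.
by apply: (@syz_inj _ _ (minpres (minimal_syzygy n M))); rewrite linear0.
Qed.

Definition minimal_resolution M : proj_resolution M :=
  @ProjResolution A M (fun n => PC (minimal_syzygy n M)) (cm M) (minimal_diff M)
    (fun n => @cov_projective _ _ (minpres (minimal_syzygy n M)))
    (@cov_surj _ _ (minpres M)) (@minimal_diff_image M 0) (@minimal_diff_exact M).

(** If the n-th syzygy is 0, its cover equals the image of the next syzygy, which is radical; so the
    cover is 0. *)
Lemma finite_gldim_of_Om b :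
  (forall n M (z : Om n M), (b <= n)%N -> z = 0) -> finite_gldim A.
Proof.
move=> Om0; exists b => M; exists (minimal_resolution M) => n bn.
apply: (nakayama J3) => /= x.
have /(@syz_exact _ _ (minpres _))[w <-] : cm (minimal_syzygy n M) x = 0.
  by move: (cm _ x); rewrite minimal_syzygyE => y; exact/Om0/ltnW.
exact: rad_oi.
Qed.

End MinimalResolution.

(** * Ext and homological dimensions *)

Section ExtVanishing.
Variable A : pzRingType.
Implicit Types M N S T X C D I : lmodType A.

(** The syzygies of P and of the free resolution are stably related. Past degree d the kernel in P
    is the image of a zero module, so every map on it extends. *)
Lemma projdim_Ext0 M d T n : projdim_le M d -> (d < n)%N -> forall c : Ext n M T, c = 0.
Proof.
case: n => // n [P P0] dn; apply/Ext_extension.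
have [Z [p [ps pE srZ]]] : exists (Z : lmodType A) (p : {linear P n -> Z}),
    [/\ forall y, exists x, p x = y,
        forall x, p x = 0 <-> exists y, pres_diff P n y = x &
        stable_retract (syzygy M n) Z].
  elim: n {dn} => [|n [Z [p [ps pE srZ]]]].
    exists M, (pres_aug P); split; [exact: pres_aug_surj|exact: pres_exact0|].
    by apply: isomorphic_stable_retract; exists idfun, idfun.
  have [|q qE] := kernel_lift (f := p) (g := pres_diff P n).
    by move=> y; apply/pE; exists y.
  exists (kernel_module p), q; split.
  - move=> w; have /pE[y yw] := kernel_mem w; exists y.
    by apply/val_inj; rewrite qE.
  - move=> x; rewrite -pres_exactS -qE; split=> [->//|qx].
    exact/val_inj.
  - exact: (stable_retract_syz (free_presentation _)
      (kernel_presentation (@pres_proj _ _ P n) ps)).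
apply: (extension_property_retract
  (p' := kernel_presentation (@pres_proj _ _ P n) ps) srZ).
move=> f; exists \0 => w; suff -> : w = 0 by rewrite !linear0.
have /pE[y yw] := kernel_mem w; apply/val_inj.
by rewrite -[LHS]yw (P0 n.+1 dn y) linear0.
Qed.

(** Dimension shifting along 0 -> C -> I -> D -> 0 with I injective, done by explicit extension and
    correction of maps. *)
Lemma extension_property_shift M C I D (i : {linear C -> I}) (d : {linear I -> D})
    (p : presentation M) (p' : presentation (syz p)) :
    injective i -> (forall y, exists x, d x = y) ->
    (forall x, d x = 0 <-> exists c, i c = x) -> injective_module I ->
  extension_property p D -> extension_property p' C.
Proof.
move=> ii ds dE injI ep f.
have [phi phiE] := injI _ _ (syz_incl p') (i \o f) (@syz_inj _ _ p').
have [|g gE] := factor_surj (q := cov_map p') (f := d \o phi) (@cov_surj _ _ p').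
  move=> x /(@syz_exact _ _ p')[w <-]; rewrite /= phiE.
  by apply/dE; exists (f w).
have [h hE] := ep g.
have [psi psiE] := @cov_projective _ _ p _ _ d h ds.
have [|k kE] := @factor_inj _ _ _ _ i (phi \- (psi \o syz_incl p \o cov_map p')) ii.
  by move=> v; apply/dE; rewrite linearB /= psiE hE gE subrr.
exists k => w; apply: ii; rewrite kE /= cov_map_incl !linear0 addr0.
exact: phiE.
Qed.

(** Shift d times along the cosyzygies of T. The last one, C, fills I^d because I^(d+1) = 0, so
    every map to C extends. *)
Lemma injdim_Ext0 M d T n : injdim_le T d -> (d < n)%N -> forall c : Ext n M T, c = 0.
Proof.
case: n => // n [I I0] dn; apply/Ext_extension.
have [C [i [ii iE shift]]] : exists (C : lmodType A) (i : {linear C -> I d}),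
    [/\ injective i, forall x, ires_diff I d x = 0 <-> exists c, i c = x &
        forall k, extension_property (free_presentation (syzygy M k)) C ->
          extension_property (free_presentation (syzygy M (d + k))) T].
  elim: d {I0 dn} => [|d [C [i [ii iE shift]]]].
    by exists T, (ires_aug I); split; [exact: ires_aug_inj|exact: ires_exact0|].
  have [|q qE] := kernel_lift (f := ires_diff I d.+1) (g := ires_diff I d).
    by move=> y; apply/ires_exactS; exists y.
  exists (kernel_module (ires_diff I d.+1)), (kernel_incl (ires_diff I d.+1)).
  split; first exact: val_inj.
    by move=> x; split=> [/kernel_elt[w wx]|[w <-]]; [exists w|exact: kernel_mem].
  move=> k ep; rewrite addSnnS; apply: shift.
  apply: (extension_property_shift (i := i) (d := q) ii _ _ (@ires_inj _ _ I d) ep).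
    move=> w; have /ires_exactS[y yw] := kernel_mem w; exists y.
    by apply/val_inj; rewrite qE.
  move=> x; rewrite -iE -qE; split=> [->//|qx]; exact/val_inj.
rewrite -(subnKC (ltnSE dn)); apply: shift => f.
have [g gE] := @ires_inj _ _ I d _ _ (syz_incl (free_presentation _)) (i \o f)
  (@syz_inj _ _ (free_presentation _)).
have [|h hE] := factor_inj (f := g) ii.
  by move=> v; apply/iE; exact: (I0 d.+1 (ltnSn d)).
by exists h => w; apply: ii; rewrite hE gE.
Qed.

Lemma Ext_self_isomorphic S T n : isomorphic S T ->
  (forall c : Ext n.+1 S T, c = 0) -> forall c : Ext n.+1 S S, c = 0.
Proof.
move=> [f [g [gf fg]]] /Ext_extension ep; apply/Ext_extension => h.
have [k kE] := ep (f \o h); exists (g \o k) => w.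
by rewrite /= kE /= gf.
Qed.

Lemma Ext_isomorphic S T X n : isomorphic S T ->
  (forall c : Ext n.+1 T X, c = 0) -> forall c : Ext n.+1 S X, c = 0.
Proof.
move=> ST /Ext_extension ep; apply/Ext_extension.
apply: extension_property_retract ep.
elim: n => [|n IH]; first exact: isomorphic_stable_retract.
exact: (stable_retract_syz (free_presentation _) (free_presentation _)).
Qed.

End ExtVanishing.

Theorem theorem2 (A : pzRingType)
    (semisimpleAJ : semisimple_ring (jacobson_quotient A))
    (J3_0 : forall x y z : A, x \in jacobson A -> y \in jacobson A ->
        z \in jacobson A -> x * y * z = 0) :
  let assertion1 := finite_gldim A in
  let assertion2 :=
    exists m : nat, (0 < m)%N /\
      forall S : lmodType A, simple_module S ->
        forall n : nat, (m <= n)%N -> forall x : Ext n S S, x = 0 in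
  let assertion3 :=
    forall S : lmodType A, simple_module S ->
      finite_projdim S \/ finite_injdim S in
  (assertion1 <-> assertion2) /\ (assertion2 <-> assertion3).
Proof.
move=> a1 a2 a3.
have a12 : a1 -> a2.
  move=> [d pd]; exists d.+1; split=> // S _ n dn; exact: projdim_Ext0 (pd S) dn.
have a21 : a2 -> a1.
  move=> [m [m0 mP]].
  have [b bP] := Om_eventually0 semisimpleAJ J3_0 m0 mP.
  exact: finite_gldim_of_Om bP.
have a32 : a3 -> a2.
  move=> fin; have [v [L LP]] := finitely_many_simples semisimpleAJ J3_0.
  have /choice[d dP] : forall i, exists d, forall S, simple_module S ->
      isomorphic S (L i) -> forall n, (d < n)%N -> forall x : Ext n S S, x = 0.
    (* [L i] need not be simple; if no simple module is isomorphic to it, the bound 0 holds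
       vacuously. *)
    move=> i; have [[T [sT TL]]|nT] :=
      pselect (exists T, simple_module T /\ isomorphic T (L i)); last first.
      by exists 0%N => S sS SL; case: nT; exists S.
    have [d dT] : exists d, forall n S, (d < n)%N -> isomorphic S T ->
        forall x : Ext n S S, x = 0.
      have [[d pd]|[d id]] := fin T sT; exists d => -[//|n] S dn ST.
        apply: (Ext_isomorphic ST).
        exact: projdim_Ext0 pd dn.
      exact: (Ext_self_isomorphic ST (injdim_Ext0 id dn)).
    exists d => S sS SL n dn; apply: (dT n S dn).
    exact: isomorphic_trans SL (isomorphic_sym TL).
  exists (\max_(i < v) d i).+1; split=> // S sS n mn.
  have [i iv SL] := LP S sS; apply: (dP i S sS SL); apply: leq_ltn_trans mn.
  exact: (leq_bigmax (Ordinal iv)).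
split; split=> // h.
by move=> S sS; left; have [d pd] := a21 h; exists d.
Qed.
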